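(* Let $\langle H, m\rangle$ be a body-bar periodic orbit graph with $m : E(H)^+ \to \mathbb{Z}^3$. Then $\langle H, m\rangle$ is generically minimally rigid as a body-bar periodic orbit graph on the three-dimensional fixed torus $\mathcal{T}_0^3$ if and only if both of the following hold: 1. $|E(H)| = 6|V(H)| - 3$; 2. for all non-empty subsets $Y \subseteq E(H)$ of edges, $$|Y| \le 6|V(Y)| - 6 + \sum_{i=1}^{|\mathcal{G}_{\mathcal{C}}(Y)|} (3-i).$$
   Context: Body-bar periodic orbit graphs. A body-bar periodic orbit graph $\langle H, m\rangle$ (here in dimension $d=3$) is a finite multigraph $H$ (multiple edges and loops allowed) together with a gain assignment $m : E(H)^+ \to \mathbb{Z}^3$ on its (arbitrarily) oriented edges. An edge from $B_\alpha$ to $B_\beta$ with gain $m_e$ is written $e = \{B_\alpha, B_\beta; m_e\}$, and $\{B_\alpha,B_\beta;m_e\} = \{B_\beta,B_\alpha;-m_e\}$. The vertices of $H$ are called bodies. Gain space. For $Y \subseteq E(H)$, $V(Y)$ is the set of vertices incident with edges of $Y$. The net gain of a cycle is the sum of the gains of its edges, with sign $+$ or $-$ according to the direction of traversal. $\mathcal{G}_{\mathcal{C}}(Y)$ is the $\mathbb{Z}$-span in $\mathbb{Z}^3$ of the net gains of the cycles of the graph $(V(Y), Y)$ (loops count as cycles), and $|\mathcal{G}_{\mathcal{C}}(Y)|$ denotes its dimension (rank). An empty sum is $0$. Bar-joint frameworks on the fixed torus. $\mathcal{T}_0^3 = \mathbb{R}^3/\mathbb{Z}^3 = [0,1)^3$.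 A bar-joint periodic orbit framework $(\langle G, m\rangle, p)$ consists of a finite multigraph $G$ with gains $m_e \in \mathbb{Z}^3$ on its edges (same conventions) and $p : V(G) \to \mathcal{T}_0^3$, $p_i=p(v_i)$, with $p_i \ne p_j$ whenever $v_i,v_j$ are joined by an edge. An infinitesimal motion is a map $u : V(G) \to \mathbb{R}^3$ with $(u_i - u_j)\cdot(p_i - p_j - m_e) = 0$ for every edge $e = \{v_i, v_j; m_e\}$. It is trivial if it is a translation (all $u_i$ equal). The framework is infinitesimally rigid on $\mathcal{T}_0^3$ if all its infinitesimal motions are trivial. The rigidity matrix has one row for each edge $e=\{v_i,v_j;m_e\}$, with entries $p_i-(p_j+m_e)$ in the three columns of $v_i$, $(p_j+m_e)-p_i$ in the three columns of $v_j$, and $0$ elsewhere. The position $p$ is generic if every minor of this matrix whose determinant is not identically zero (as a function of $p$) is nonzero at $p$. Body-bar frameworks and their rigidity. The induced bar-joint orbit graph $\langle G_H, m_H\rangle$ is obtained by replacing each vertex (body) of $H$ by a finite isostatic (generically minimally rigid in $\mathbb{R}^3$) bar-joint graph, all of whose edges get gain $(0,0,0)$, and realizing each edge $\{B_\alpha,B_\beta;m_e\}$ of $H$ as an edge with gain $m_e$ joining a vertex of the body $B_\alpha$ to a vertex of the body $B_\beta$, where the bars coming from edges of $H$ are pairwise disjoint (distinct endpoints; in particular the two ends of a loop are distinct vertices of its body). Each body spans an affine subspace of dimension at least $2$ and, up to translation, lies within $[0,1)^3$; the particular choice of isostatic graphs is immaterial. A body-bar framework is generic if the induced bar-joint framework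 is generic, and infinitesimally rigid on $\mathcal{T}_0^3$ if the induced bar-joint framework is infinitesimally rigid on $\mathcal{T}_0^3$. $\langle H,m\rangle$ is generically rigid on $\mathcal{T}_0^3$ if it is infinitesimally rigid on $\mathcal{T}_0^3$ at all generic positions, and generically minimally rigid if it is generically rigid and has exactly $|E(H)| = 6|V(H)|-3$ edges (equivalently, it is generically rigid and its edges are independent as rows of the rigidity matrix). *)

(* Defs.v *)
From HB Require Import structures.
From mathcomp Require Import all_boot all_order all_algebra.
From mathcomp Require Import boolp reals.

Set Implicit Arguments.
Unset Strict Implicit.
Unset Printing Implicit Defensive.

Import Order.TTheory GRing.Theory Num.Theory.
Local Open Scope ring_scope.

(* A finite multigraph (loops and parallel edges allowed) with gains in Z^3.
   Used both for body-bar orbit graphs (vertices = bodies) and for bar-joint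
   orbit graphs (vertices = joints).  Each edge is stored with one chosen
   orientation: e = {src e, dst e; gain e}. *)
Record gain_graph := GainGraph {
  vert : finType;
  edge : finType;
  src : edge -> vert;
  dst : edge -> vert;
  gain : edge -> 'rV[int]_3
}.

Section GainSpace.
Variable H : gain_graph.
Implicit Types (Y : {set edge H}) (d : edge H * bool).

Definition vertices_of Y : {set vert H} :=
  [set v | [exists e in Y, (v == src e) || (v == dst e)]].

(* (e, false) is e traversed from src to dst, (e, true) the reverse. *)
Definition dart_tail d : vert H := if d.2 then dst d.1 else src d.1.
Definition dart_head d : vert H := if d.2 then src d.1 else dst d.1.
Definition dart_gain d : 'rV[int]_3 := if d.2 then - gain d.1 else gain d.1.

(* Distinctness of the edges only matters in length 2, where it rules out
   traversing one edge back and forth. *)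
Definition is_cycle Y (c : seq (edge H * bool)) : bool :=
  [&& c != [::],
      all (fun d => d.1 \in Y) c,
      cycle (fun d d' => dart_head d == dart_tail d') c,
      uniq (map dart_tail c) & uniq (map fst c)].

Definition net_gain (c : seq (edge H * bool)) : 'rV[int]_3 :=
  \sum_(d <- c) dart_gain d.

Definition gain_space Y (z : 'rV[int]_3) : Prop :=
  exists (k : nat) (c : 'I_k -> seq (edge H * bool)) (a : 'I_k -> int),
    (forall i, is_cycle Y (c i)) /\ z = \sum_(i < k) a i *: net_gain (c i).

Definition Z_independent k (b : 'M[int]_(k, 3)) : Prop :=
  forall a : 'rV[int]_k, a *m b = 0 -> a = 0.

(* The rank of the Z-module [gain_space Y]: the largest size of a Z-linearly
   independent family in it.  Such families in Z^3 have at most 3 members. *)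
Definition gain_rank Y : nat :=
  (\max_(k < 4 | `[< exists b : 'M[int]_(k, 3),
      (forall i, gain_space Y (row i b)) /\ Z_independent b >]) k)%N.

End GainSpace.

Section BarJoint.
Variables (R : realType) (G : gain_graph).
Implicit Types (p u : vert G -> 'rV[R]_3).

Definition dot (x y : 'rV[R]_3) : R := \sum_(c < 3) x 0 c * y 0 c.

Definition bar_vector p (e : edge G) : 'rV[R]_3 :=
  p (src e) - p (dst e) - map_mx intr (gain e).

Definition rigidity_matrix p : 'M[R]_(#|edge G|, #|{: vert G * 'I_3}|) :=
  \matrix_(i, j)
    let e := enum_val i in
    let v := (enum_val j).1 in
    let c := (enum_val j).2 in
    ((v == src e)%:R - (v == dst e)%:R) * bar_vector p e 0 c.

(* Minors are polynomials in the coordinates of the joints, so one that is not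
   identically zero on (R^3)^V is not identically zero on ([0,1)^3)^V either. *)
Definition generic p : Prop :=
  forall k (f : 'I_k -> 'I_#|edge G|) (g : 'I_k -> 'I_#|{: vert G * 'I_3}|),
    (exists q : vert G -> 'rV[R]_3,
       \det (mxsub f g (rigidity_matrix q)) != 0) ->
    \det (mxsub f g (rigidity_matrix p)) != 0.

Definition infinitesimal_motion p u : Prop :=
  forall e, dot (u (src e) - u (dst e)) (bar_vector p e) = 0.

Definition translation u : Prop := exists t, forall v, u v = t.

(* The skew matrix S encodes x |-> w x x (cross product) in row convention. *)
Definition infinitesimal_isometry p u : Prop :=
  exists (t : 'rV[R]_3) (S : 'M[R]_3),
    S^T = - S /\ forall v, u v = p v *m S + t.

Definition in_torus p : Prop := forall v c, 0 <= p v 0 c < 1.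

Definition distinct_ends p : Prop := forall e, p (src e) != p (dst e).

Definition inf_rigid_torus p : Prop :=
  forall u, infinitesimal_motion p u -> translation u.

(* Ordinary (non-periodic) rigidity in R^3, meant for graphs with zero gains.
   For loopless such graphs generic positions have distinct edge ends. *)
Definition generically_rigid_euclid : Prop :=
  forall p, generic p ->
    forall u, infinitesimal_motion p u -> infinitesimal_isometry p u.

End BarJoint.

Definition delete_edge (G : gain_graph) (e : edge G) : gain_graph :=
  @GainGraph (vert G) {e' : edge G | e' != e}
    (fun e' => src (val e')) (fun e' => dst (val e'))
    (fun e' => gain (val e')).

(* Minimality excludes loops and parallel edges, as these contribute
   dependent rows. *)
Definition isostatic (R : realType) (G : gain_graph) : Prop :=
  [/\ forall e : edge G, gain e = 0,
      generically_rigid_euclid R G &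
      forall e : edge G, ~ generically_rigid_euclid R (delete_edge e)].

(* A choice of the data that turns a body-bar orbit graph H into a bar-joint
   orbit graph.  A body whose joints affinely span at least a plane has at
   least three joints. *)
Record body_choice (R : realType) (H : gain_graph) := BodyChoice {
  body : vert H -> gain_graph;
  body_isostatic : forall a, isostatic R (body a);
  body_card : forall a, (3 <= #|vert (body a)|)%N;
  bar_src : forall e : edge H, vert (body (src e));
  bar_dst : forall e : edge H, vert (body (dst e));
  bar_end : edge H * bool -> {a : vert H & vert (body a)} := fun d =>
    if d.2 then Tagged (fun a => vert (body a)) (bar_dst d.1)
    else Tagged (fun a => vert (body a)) (bar_src d.1);
  bar_end_inj : injective bar_end
}.

Section BodyBar.
Variables (R : realType) (H : gain_graph) (B : body_choice R H).

Definition induced_joint : finType := {a : vert H & vert (body B a)}.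
Definition induced_bar : finType :=
  ({a : vert H & edge (body B a)} + edge H)%type.

Definition joint_of (a : vert H) (j : vert (body B a)) : induced_joint :=
  Tagged (fun a => vert (body B a)) j.

Definition induced_graph : gain_graph :=
  @GainGraph induced_joint induced_bar
    (fun b => match b with
              | inl x => joint_of (src (tagged x))
              | inr e => joint_of (bar_src B e)
              end)
    (fun b => match b with
              | inl x => joint_of (dst (tagged x))
              | inr e => joint_of (bar_dst B e)
              end)
    (fun b => match b with inl _ => 0 | inr e => gain e end).

(* The affine span of a body has dimension at least 2.  As positions are taken
   in [0,1)^3, every body lies in the unit cube. *)
Definition bodies_span (p : vert induced_graph -> 'rV[R]_3) : Prop :=
  forall a : vert H,
    (2 <= \dim <<[seq (p (joint_of i) - p (joint_of j))%R
                 | i <- enum (vert (body B a)),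
                   j <- enum (vert (body B a))]>>%VS)%N.

Definition body_bar_position (p : vert induced_graph -> 'rV[R]_3) : Prop :=
  [/\ in_torus p, distinct_ends p & bodies_span p].

Definition generically_rigid : Prop :=
  forall p : vert induced_graph -> 'rV[R]_3,
    body_bar_position p -> generic p -> inf_rigid_torus p.

Definition generically_minimally_rigid : Prop :=
  generically_rigid /\ #|edge H|%:Z = 6 * #|vert H|%:Z - 3.

End BodyBar.

(* Main.v *)
Require Import Defs.
From mathcomp Require Import all_boot all_order all_algebra.
From mathcomp Require Import boolp reals.
From mathcomp Require Import zify ring lra.
Set Implicit Arguments.
Unset Strict Implicit.
Unset Printing Implicit Defensive.
Import Order.TTheory GRing.Theory Num.Theory.
Local Open Scope ring_scope.

(** Attach to every body a screw motion: a rotation vector w and a translation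
    vector t, so that its joint at x moves with velocity [cross w x + t].  At a generic position each body is rigid, so the
    infinitesimal motions of the framework are the screw assignments that
    satisfy one linear equation per bar: the row of a bar along a line with
    direction d through x pairs the Pluecker vector [(cross x d, d)] of that line with
    the difference of the motions of the two bodies, after the second body has
    been translated by the gain.  There are 6|V| unknowns and the translations
    always give three solutions, so the framework is rigid exactly when this
    system has rank 6|V| - 3.

    If all bars that join the same two bodies with the same gain as e were
    present, the equations of e would say that the two bodies move as one rigid
    body, up to the gain; such an assignment is called [linked] along e.  The
    assignments linked along all edges of Y can be computed exactly.  Inside a
    component all motions follow from the motion of one body, because a
    potential transports gains along walks.  The motion of that body is subject
    only to the requirement that its rotation vector be parallel to all net
    gains of cycles; this leaves 6, 4 or 3 free parameters when the rank of the
    gain space is 0, 1 or at least 2.  This is where the sum in the bound comes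
    from ([fixed_axis_coords], [gain_potential], [linked_free],
    [linked_determined]).

    Necessity: at a generic position the |E| = 6|V| - 3 rows are independent,
    hence so are the rows of Y.  All of them vanish on the linked assignments,
    and the dimension of that space bounds |Y| ([rank_bounded]).

    Sufficiency: the Pluecker vectors of lines span the whole six-dimensional
    space, so every bar may be placed on one of six lines whose rows span all
    the equations that link its two bodies.  The count says that the rows
    available to any set F of edges have rank at least |F|, and Rado's theorem
    ([rado]) picks one line per edge so that the chosen rows are independent
    ([special_position]).  The ends of distinct bars are distinct joints, so
    these choices can be realised simultaneously.  Minors of the matrices
    involved are polynomial along every line of positions, hence some generic
    position keeps the rank of the special one ([exists_generic]), is therefore
    rigid, and forces rigidity at all generic positions because these maximise
    the rank ([generic_max_rank]). *)

(** * Homogeneous linear systems indexed by finite types *)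

Section LinearSystem.
Variables (F : realFieldType) (I J : finType).
Implicit Types (a : I -> J -> F) (A B : {set I}) (D : {set J}) (x : J -> F).

Definition coef_row (f : J -> F) : 'rV[F]_#|J| := \row_j f (enum_val j).

Definition row_space a A : 'M[F]_#|J| :=
  (\sum_(i in A) <<coef_row (a i)>>)%MS.

Definition rk a A : nat := \rank (row_space a A).

Definition solves a A x : Prop :=
  forall i, i \in A -> \sum_j a i j * x j = 0.

(** [determined_by] bounds the dimension of the solution space by |D| from above,
    [free_on] bounds it from below; the two together are how dimensions of
    solution spaces are computed in what follows. *)
Definition determined_by a A D : Prop :=
  forall x, solves a A x -> (forall j, j \in D -> x j = 0) ->
  forall j, x j = 0.

Definition free_on a A D : Prop :=
  forall g : J -> F, exists2 x, solves a A x & forall j, j \in D -> x j = g j.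

Lemma coef_row_dot (f : J -> F) (y : 'rV[F]_#|J|) :
  coef_row f *m y^T = (\sum_j f j * y 0 (enum_rank j))%:M.
Proof.
apply/matrixP=> i k; rewrite !ord1 !mxE eqxx mulr1n.
rewrite [RHS](reindex_onto enum_val enum_rank) /=; last by move=> j _; rewrite enum_rankK.
apply: eq_big => [j|j _]; first by rewrite enum_valK eqxx.
by rewrite !mxE enum_valK.
Qed.

Lemma row_space_kerP a A (y : 'rV[F]_#|J|) :
  solves a A (fun j => y 0 (enum_rank j)) <-> (row_space a A <= kermx y^T)%MS.
Proof.
split=> [sol|/sumsmx_subP sub i Ai].
  apply/sumsmx_subP=> i Ai; rewrite genmxE; apply/sub_kermxP.
  by rewrite coef_row_dot sol // raddf0.
have:= sub i Ai; rewrite genmxE => /sub_kermxP; rewrite coef_row_dot.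
by move/matrixP/(_ 0 0); rewrite !mxE eqxx mulr1n.
Qed.

Lemma row_space_setU a A B :
  (row_space a (A :|: B) :=: row_space a A + row_space a B)%MS.
Proof.
apply/eqmxP/andP; split.
  apply/sumsmx_subP=> i; rewrite inE => /orP[Ai|Bi].
    by apply: submx_trans (addsmxSl _ _); apply: (sumsmx_sup i).
  by apply: submx_trans (addsmxSr _ _); apply: (sumsmx_sup i).
by rewrite addsmx_sub; apply/andP; split; apply/sumsmx_subP=> i iin;
  apply: (sumsmx_sup i); rewrite // inE iin ?orbT.
Qed.

Lemma row_spaceS a A B : A \subset B -> (row_space a A <= row_space a B)%MS.
Proof.
by move/subsetP=> AB; apply/sumsmx_subP=> i Ai; apply: (sumsmx_sup i); rewrite ?AB.
Qed.

Lemma rkS a A B : A \subset B -> (rk a A <= rk a B)%N.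
Proof. by move=> AB; apply/mxrankS/row_spaceS. Qed.

(** The sum of two row spaces has dimension r(A) + r(B) minus that of their
    intersection, and the rows indexed by A :&: B lie in that intersection. *)
Lemma rk_submod a A B :
  (rk a (A :|: B) + rk a (A :&: B) <= rk a A + rk a B)%N.
Proof.
rewrite /rk row_space_setU -(mxrank_sum_cap (row_space a A)) leq_add2l.
by apply: mxrankS; rewrite sub_capmx !row_spaceS ?subsetIl ?subsetIr.
Qed.

Lemma rk0 a : rk a set0 = 0%N.
Proof. by rewrite /rk /row_space big_set0 mxrank0. Qed.

Lemma rk_card a A : (rk a A <= #|A|)%N.
Proof.
rewrite -sum1_card /rk /row_space.
apply: (big_ind2 (fun (U : 'M[F]_#|J|) n => (\rank U <= n)%N)).
- by rewrite mxrank0.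
- by move=> U m V n Um Vn; apply: leq_trans (mxrank_adds_leqif _ _) _; apply: leq_add.
by move=> i _; rewrite genmxE rank_leq_row.
Qed.

(** Passage to the explicit coefficient matrix, whose minors carry genericity. *)
Lemma rk_setT a :
  rk a setT = \rank (\matrix_(i < #|I|, j < #|J|) a (enum_val i) (enum_val j)).
Proof.
apply: eqmx_rank; apply/andP; split.
  apply/sumsmx_subP=> i _; rewrite genmxE.
  apply: etrans (row_sub (enum_rank i) _); congr (_ <= _)%MS.
  by apply/rowP=> j; rewrite !mxE enum_rankK.
apply/row_subP=> i; apply: (sumsmx_sup (enum_val i)) => //; rewrite genmxE.
by rewrite (_ : row i _ = coef_row (a (enum_val i))) //; apply/rowP=> j; rewrite !mxE.
Qed.

End LinearSystem.

Section Dimension.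
Variables (F : realFieldType) (I J : finType).
Implicit Types (a : I -> J -> F) (A : {set I}) (D : {set J}).

Definition unit_coef (j k : J) : F := (j == k)%:R.
Definition coord_space D : 'M[F]_#|J| := row_space unit_coef D.

Lemma unit_coef_sum j (x : J -> F) : \sum_k unit_coef j k * x k = x j.
Proof.
rewrite (bigD1 j) //= /unit_coef eqxx mul1r big1 ?addr0 // => k.
by rewrite eq_sym => /negPf->; rewrite mul0r.
Qed.

Lemma coord_space_kerP D (y : 'rV[F]_#|J|) :
  (forall j, j \in D -> y 0 (enum_rank j) = 0) <->
  (coord_space D <= kermx y^T)%MS.
Proof.
rewrite -row_space_kerP; split=> y0 j Dj; last by rewrite -[RHS](y0 j Dj) unit_coef_sum.
by rewrite unit_coef_sum y0.
Qed.

Lemma coord_space_rank_leq D : (\rank (coord_space D) <= #|D|)%N.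
Proof. exact: rk_card. Qed.

Lemma full_of_ker0 m (U : 'M[F]_(m, #|J|)) :
  (forall y : 'rV_#|J|, (U <= kermx y^T)%MS -> y = 0) -> \rank U = #|J|.
Proof.
move=> inj; rewrite -mxrank_tr; apply/eqP; rewrite -[_ == _]/(row_free _).
rewrite -kermx_eq0; apply/eqP/row_matrixP=> i; rewrite row0.
apply: inj; apply/sub_kermxP; apply: trmx_inj; rewrite trmx_mul trmxK trmx0.
by rewrite -row_mul mulmx_ker row0.
Qed.

(** The |D| and |~: D| coordinate forms together span everything, so neither
    family can be dependent. *)
Lemma coord_space_rank D : \rank (coord_space D) = #|D|.
Proof.
apply/eqP; rewrite eqn_leq coord_space_rank_leq /=.
have full : \rank (coord_space D + coord_space (~: D)) = #|J|.
  apply: full_of_ker0 => y; rewrite addsmx_sub => /andP[].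
  move=> /coord_space_kerP yD /coord_space_kerP yC.
  apply/rowP=> k; rewrite mxE -[k]enum_valK.
  by case: (boolP (enum_val k \in D)) => kD; [apply: yD|apply: yC; rewrite inE].
have := mxrank_adds_leqif (coord_space D) (coord_space (~: D)).
rewrite full => -[le _].
have := leq_trans le (leq_add (leqnn _) (coord_space_rank_leq (~: D))).
by rewrite -[leqLHS](cardsC D) leq_add2r.
Qed.

(** Only 0 is annihilated by the rows of the system together with the
    coordinate forms of D, so these span the dual space. *)
Lemma determined_rk a A D : determined_by a A D -> (#|J| <= rk a A + #|D|)%N.
Proof.
move=> det; have full : \rank (row_space a A + coord_space D) = #|J|.
  apply: full_of_ker0 => y; rewrite addsmx_sub => /andP[].
  move=> /row_space_kerP sol /coord_space_kerP yD.
  apply/rowP=> k; rewrite mxE -[k]enum_valK; exact: (det _ sol).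
rewrite -full; apply: leq_trans (mxrank_adds_leqif _ _) _.
by rewrite leq_add2l coord_space_rank_leq.
Qed.

(** A form y in both spaces is supported on D, and its own coefficients on D
    extend to a solution x.  Since y vanishes on solutions, the sum of the
    squares of its coefficients, which is y(x), is 0: here the order of the
    scalars is used. *)
Lemma free_cap a A D : free_on a A D -> (row_space a A :&: coord_space D)%MS = 0.
Proof.
move=> freeD; apply/eqP; rewrite -submx0; apply/rV_subP=> y.
rewrite sub_capmx => /andP[yA yD].
have y_out j : j \notin D -> y 0 (enum_rank j) = 0.
  move=> jD; pose d : 'rV[F]_#|J| := coef_row (unit_coef j).
  have /coord_space_kerP/(submx_trans yD) :
      forall k, k \in D -> d 0 (enum_rank k) = 0.
    move=> k kD; rewrite mxE /unit_coef enum_rankK.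
    by case: eqP jD => // ->; rewrite kD.
  move/sub_kermxP/(congr1 trmx); rewrite trmx_mul trmxK trmx0.
  rewrite coef_row_dot unit_coef_sum.
  by move/matrixP/(_ 0 0); rewrite !mxE eqxx mulr1n.
have [x sol xD] := freeD (fun j => y 0 (enum_rank j)).
have /row_space_kerP/(submx_trans yA)/sub_kermxP : solves a A
    (fun j => (coef_row x) 0 (enum_rank j)).
  move=> i Ai; rewrite -[RHS](sol i Ai); apply: eq_bigr => j _.
  by rewrite mxE enum_rankK.
move/(congr1 trmx); rewrite trmx_mul trmxK trmx0 coef_row_dot.
move/matrixP/(_ 0 0); rewrite !mxE eqxx mulr1n => sum0.
have sq : \sum_j y 0 (enum_rank j) ^+ 2 = 0.
  rewrite -[RHS]sum0; apply: eq_bigr => j _.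
  by case: (boolP (j \in D)) => jD; [rewrite xD|rewrite y_out // mulr0 expr0n].
rewrite submx0; apply/eqP/rowP=> k; rewrite mxE -[k]enum_valK.
apply/eqP; rewrite -sqrf_eq0; apply/eqP.
by apply: (psumr_eq0P _ sq) => // j _; apply: sqr_ge0.
Qed.

Lemma free_rank_adds a A D :
  free_on a A D -> \rank (row_space a A + coord_space D) = (rk a A + #|D|)%N.
Proof.
move=> /free_cap cap0; have := mxrank_sum_cap (row_space a A) (coord_space D).
by rewrite cap0 mxrank0 addn0 coord_space_rank.
Qed.

Lemma free_rk a A D : free_on a A D -> (rk a A + #|D| <= #|J|)%N.
Proof. by move/free_rank_adds<-; apply: rank_leq_row. Qed.

(** The row space and the coordinate forms of D meet trivially, so under the rank
    hypothesis they span the dual space. *)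
Lemma free_determined a A D :
  free_on a A D -> (#|J| <= rk a A + #|D|)%N -> determined_by a A D.
Proof.
move=> freeD; rewrite -(free_rank_adds freeD) => full x sol xD j.
pose y := coef_row x.
have E k : y 0 (enum_rank k) = x k by rewrite mxE enum_rankK.
have yA : (row_space a A <= kermx y^T)%MS.
  apply/row_space_kerP=> i Ai; rewrite -[RHS](sol i Ai).
  by apply: eq_bigr => k _; rewrite E.
have yD : (coord_space D <= kermx y^T)%MS.
  by apply/coord_space_kerP=> k kD; rewrite E xD.
have /sub_kermxP : (1%:M <= kermx y^T)%MS.
  apply: submx_trans (_ : row_space a A + coord_space D <= _)%MS.
    by rewrite sub1mx /row_full eqn_leq rank_leq_row.
  by rewrite addsmx_sub yA.
rewrite mul1mx => /(congr1 trmx); rewrite trmxK trmx0 -E => ->.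
by rewrite mxE.
Qed.

End Dimension.

(** * Independent transversals *)

Section Rado.
Variables (E K : finType) (r : {set E * K} -> nat).
Hypotheses (r0 : r set0 = 0%N)
  (rS : forall A B : {set E * K}, A \subset B -> (r A <= r B)%N)
  (r_submod : forall A B, (r (A :|: B) + r (A :&: B) <= r A + r B)%N).
Implicit Types (A : {set E * K}) (X Y : {set E}).

Definition over A X : {set E * K} := [set z in A | z.1 \in X].

(** If deleting x violates the rank condition at X and deleting y violates it at
    Y, then both sets contain the common index e, and submodularity applied to
    the two shrunken families contradicts the condition at X :|: Y and at
    (X :&: Y) :\ e. *)
Lemma rado_shrink A (x y : E * K) :
  (forall X, (#|X| <= r (over A X))%N) -> x.1 = y.1 -> x != y ->
  (forall X, (#|X| <= r (over (A :\ x) X))%N) \/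
  (forall X, (#|X| <= r (over (A :\ y) X))%N).
Proof.
move=> hall xy1 xy.
case: (boolP [forall X : {set E}, #|X| <= r (over (A :\ x) X)]%N) => [/forallP|]; first by left.
case/forallPn=> X; rewrite -ltnNge => failX.
case: (boolP [forall Y : {set E}, #|Y| <= r (over (A :\ y) Y)]%N) => [/forallP|]; first by right.
case/forallPn=> Y; rewrite -ltnNge => failY; exfalso.
have in_fail z Z : (r (over (A :\ z) Z) < #|Z|)%N -> z.1 \in Z.
  move=> fail; apply: contraTT fail => zZ; rewrite -leqNgt.
  apply: leq_trans (hall Z) (rS _); apply/subsetP=> t; rewrite !inE.
  case/andP=> -> tZ; rewrite tZ !andbT.
  by apply: contraNneq zZ => <-.
have xX := in_fail _ _ failX; have yY := in_fail _ _ failY.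
pose e := x.1; pose Z := (X :&: Y) :\ e.
have le1 : (#|X :|: Y| <= r (over (A :\ x) X :|: over (A :\ y) Y))%N.
  apply: leq_trans (hall _) (rS _); apply/subsetP=> t; rewrite !inE.
  case/andP=> -> /orP[tX|tY]; rewrite ?tX ?tY !andbT.
    by case: (eqVneq t x) => //= ->; rewrite xy xy1 yY.
  case: (eqVneq t y) => [->|_]; last by rewrite orbT.
  by rewrite eq_sym xy -xy1 xX.
have le2 : (#|Z| <= r (over (A :\ x) X :&: over (A :\ y) Y))%N.
  apply: leq_trans (hall _) (rS _); apply/subsetP=> t; rewrite !inE.
  case/and4P=> -> te -> ->; rewrite !andbT.
  by apply/andP; split; apply: contraNneq te => ->; rewrite ?/e ?xy1.
have cZ : (#|X :&: Y| = #|Z|.+1)%N.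
  by rewrite (cardsD1 e) !inE xX {1}/e xy1 yY.
have := leq_trans (leq_add le1 le2) (r_submod _ _).
have := cardsUI X Y; move: failX failY; rewrite cZ.
by move: (r _) (r _) => rX rY; lia.
Qed.

(** Rado's theorem on independent transversals, for a rank function r: repeated
    shrinking leaves one element over each index. *)
Theorem rado A :
  (forall X, (#|X| <= r (over A X))%N) ->
  exists s : E -> K, (#|E| <= r [set (e, s e) | e : E])%N.
Proof.
have [n] := ubnP #|A|; elim: n A => // n IHn A; rewrite ltnS => leA hall.
case: (boolP [exists x in A, exists y in A, (x.1 == y.1) && (x != y)]).
  case/exists_inP=> x Ax /exists_inP[y Ay /andP[/eqP xy1 xy]].
  case: (rado_shrink hall xy1 xy) => hall'; apply: (IHn _ _ hall').
    by rewrite (cardsD1 x) Ax in leA.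
  by rewrite (cardsD1 y) Ay in leA.
move=> noxy.
have uniqA x y : x \in A -> y \in A -> x.1 = y.1 -> x = y.
  move=> Ax Ay xy1; apply/eqP; apply: contraNT noxy => xy.
  by apply/exists_inP; exists x => //; apply/exists_inP; exists y; rewrite ?xy1 ?eqxx.
have fib e : exists k, (e, k) \in A.
  have : (0 < r (over A [set e]))%N by apply: leq_trans (hall [set e]); rewrite cards1.
  case: (set_0Vmem (over A [set e])) => [->|[[e' k]]]; first by rewrite r0.
  by rewrite !inE /= => /andP[Ae' /eqP <-] _; exists k.
exists (fun e => xchoose (fib e)).
have := hall setT; rewrite cardsT => /leq_trans; apply; apply: rS.
apply/subsetP=> -[e k]; rewrite !inE andbT => Aek; apply/imsetP; exists e => //.
by apply: uniqA => //; exact: (xchooseP (fib e)).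
Qed.

End Rado.

(** * Minors, and functions that are polynomial on lines *)

Section Minors.
Variable F : fieldType.

(** A nonzero minor of order k is found by first choosing k independent rows,
    then k columns on which they stay independent. *)
Lemma minor_of_rank m n (A : 'M[F]_(m, n)) k : (k <= \rank A)%N ->
  exists (f : 'I_k -> 'I_m) (g : 'I_k -> 'I_n), \det (mxsub f g A) != 0.
Proof.
move=> kA.
have [f ff] : exists f : 'I_k -> 'I_m, row_free (rowsub f A).
  exists (fun i => maxrankfun A (widen_ord kA i)).
  rewrite (_ : rowsub _ A = rowsub (widen_ord kA) (rowsub (maxrankfun A) A)); last first.
    by apply/matrixP=> i j; rewrite !mxE.
  apply/row_freeP; have /row_freeP[B AB] := maxrowsub_free A.
  exists (B *m (rowsub (widen_ord kA) 1%:M)^T).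
  rewrite mulmxA mul_rowsub_mx AB; apply/matrixP=> i j.
  rewrite !mxE (bigD1 (widen_ord kA i)) //= !mxE eqxx mul1r big1 ?addr0.
    by congr ((nat_of_bool _)%:R); apply/eqP/eqP=> [/(congr1 val) /= E|->//]; apply: val_inj.
  by move=> l; rewrite !mxE eq_sym => /negPf->; rewrite mul0r.
exists f; have full : row_full (rowsub f A)^T by rewrite /row_full mxrank_tr.
exists (fullrankfun full).
rewrite -unitfE -[_ \is a _]/(_ \in unitmx).
rewrite -unitmx_tr -row_full_unit /row_full.
rewrite (_ : _^T = rowsub (fullrankfun full) (rowsub f A)^T) ?mxrank_fullrowsub //.
by apply/matrixP=> i j; rewrite !mxE.
Qed.

Lemma rank_of_minor m n (A : 'M[F]_(m, n)) k
    (f : 'I_k -> 'I_m) (g : 'I_k -> 'I_n) :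
  \det (mxsub f g A) != 0 -> (k <= \rank A)%N.
Proof.
rewrite -unitfE -[_ \is a _]/(_ \in unitmx) => /mxrank_unit <-.
rewrite mxsubrc; apply: leq_trans (mxrankS (rowsub_sub _ _)) _.
by rewrite -mxrank_tr trmx_mxsub -(mxrank_tr A); apply/mxrankS/rowsub_sub.
Qed.

End Minors.

Section PolynomialOnLines.
Variables (R : realFieldType) (X : finType).
Implicit Types (p q : X -> 'rV[R]_3) (f g : (X -> 'rV[R]_3) -> R).

Definition line p q (t : R) : X -> 'rV[R]_3 := fun v => p v + t *: (q v - p v).

(** Restriction to lines reduces statements about nonvanishing of polynomials in
    many variables to univariate polynomials and their finitely many roots. *)
Definition poly_on_lines f : Prop :=
  forall p q, exists P : {poly R}, forall t, f (line p q t) = P.[t].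

Lemma poly_on_lines_const c : poly_on_lines (fun=> c).
Proof. by move=> p q; exists c%:P => t; rewrite hornerC. Qed.

Lemma poly_on_lines_coord v c : poly_on_lines (fun p => p v 0 c).
Proof.
move=> p q; exists ((p v 0 c)%:P + ((q v - p v) 0 c) *: 'X) => t.
by rewrite hornerD hornerC hornerZ hornerX !mxE mulrC.
Qed.

Lemma poly_on_linesD f g :
  poly_on_lines f -> poly_on_lines g -> poly_on_lines (fun p => f p + g p).
Proof.
move=> pf pg p q; have [[P fP] [Q gQ]] := (pf p q, pg p q).
by exists (P + Q) => t; rewrite hornerD fP gQ.
Qed.

Lemma poly_on_linesM f g :
  poly_on_lines f -> poly_on_lines g -> poly_on_lines (fun p => f p * g p).
Proof.
move=> pf pg p q; have [[P fP] [Q gQ]] := (pf p q, pg p q).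
by exists (P * Q) => t; rewrite hornerM fP gQ.
Qed.

Lemma poly_on_linesN f : poly_on_lines f -> poly_on_lines (fun p => - f p).
Proof.
by move=> pf p q; have [P fP] := pf p q; exists (- P) => t; rewrite hornerN fP.
Qed.

Lemma poly_on_linesB f g :
  poly_on_lines f -> poly_on_lines g -> poly_on_lines (fun p => f p - g p).
Proof. by move=> pf pg; apply: poly_on_linesD => //; apply: poly_on_linesN. Qed.

Lemma poly_on_lines_det n (A : (X -> 'rV[R]_3) -> 'M[R]_n) :
  (forall i j, poly_on_lines (fun p => A p i j)) ->
  poly_on_lines (fun p => \det (A p)).
Proof.
move=> pA p q.
have /choice[P AP] : forall ij : 'I_n * 'I_n, exists P : {poly R},
    forall t, A (line p q t) ij.1 ij.2 = P.[t] by move=> [i j]; apply: pA.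
exists (\det (\matrix_(i, j) P (i, j))) => t.
rewrite -[RHS]/(horner_eval t _) -det_map_mx; congr (\det _).
by apply/matrixP=> i j; rewrite !mxE; apply: (AP (i, j) t).
Qed.

Lemma line0 p q : line p q 0 = p.
Proof. by apply/funext=> v; rewrite /line scale0r addr0. Qed.

Lemma line1 p q : line p q 1 = q.
Proof. by apply/funext=> v; rewrite /line scale1r addrC subrK. Qed.

Lemma small_nonroot (P : {poly R}) (e : R) : P != 0 -> 0 < e ->
  exists2 t, 0 < t < e & P.[t] != 0.
Proof.
move=> P0 e0; apply: contrapT => noroot.
pose s := [seq e / n.+2%:R | n <- iota 0 (size P)].
suff : (size s < size P)%N by rewrite size_map size_iota ltnn.
apply: max_poly_roots => //.
  apply/allP=> t /mapP[n _ ->]; apply: contrapT => /negP; rewrite /root => Pt.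
  apply: noroot; exists (e / n.+2%:R) => //.
  rewrite divr_gt0 ?ltr0n //= ltr_pdivrMr ?ltr0n // ltr_pMr //.
  by rewrite (ltr_nat _ 1).
rewrite map_inj_uniq ?iota_uniq // => m n /(mulfI (lt0r_neq0 e0))/invr_inj/eqP.
by rewrite eqr_nat eqSS eqSS => /eqP.
Qed.

Lemma small_perturbation (K : finType) (a b : K -> R) : (forall k, 0 < a k) ->
  exists2 e, 0 < e & forall t, 0 < t < e -> forall k, 0 < a k + t * b k.
Proof.
move=> a0; pose S := \sum_k `|b k| / a k.
have term0 k : 0 <= `|b k| / a k by rewrite divr_ge0 // ltW.
have S0 : 0 <= S by apply: sumr_ge0.
(* Each |b k| / a k is at most S, so t (1 + S) < 1 gives t |b k| < a k. *)
exists (1 + S)^-1 => [|t /andP[t0 te] k]; first by rewrite invr_gt0; lra.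
have bS : `|b k| / a k <= S.
  by rewrite /S (bigD1 k) //= lerDl; apply: sumr_ge0.
have tS : t * (1 + S) < 1 by rewrite -ltr_pdivlMr ?div1r; lra.
have : t * (`|b k| / a k) < 1.
  by apply: le_lt_trans tS; rewrite ler_wpM2l ?ltW //; lra.
rewrite mulrA ltr_pdivrMr // mul1r => tb.
have := ler_norm (- b k); rewrite normrN -(ler_pM2l t0) => nb; lra.
Qed.

(** Start in the open cube at a point where all earlier functions are nonzero and
    move slightly towards a point where the next one is: along this line the
    product of all of them is a nonzero polynomial in t. *)
Lemma common_nonvanishing (I : finType) (f : I -> (X -> 'rV[R]_3) -> R) :
  (forall i, poly_on_lines (f i)) -> (forall i, exists q, f i q != 0) ->
  exists2 q : X -> 'rV[R]_3, (forall v c, 0 < q v 0 c < 1) & forall i, f i q != 0.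
Proof.
move=> pf fn0.
suff H (s : seq I) : exists2 q : X -> 'rV[R]_3, (forall v c, 0 < q v 0 c < 1) &
    forall i, i \in s -> f i q != 0.
  by have [q q01 fq] := H (enum I); exists q => // i; apply: fq; rewrite mem_enum.
elim: s => [|i s [q0 q01 fq0]].
  by exists (fun=> const_mx 2^-1) => // v c; rewrite mxE; lra.
have [q1 fq1] := fn0 i.
have /choice[P fP] := fun j => pf j q0 q1.
have Q0 : \prod_(j <- i :: s) P j != 0.
  rewrite prodf_seq_neq0; apply/allP=> j; rewrite inE => /orP[/eqP->|js] /=.
    by apply: contraNneq fq1 => Pi0; rewrite -(line1 q0 q1) fP Pi0 horner0.
  by apply: contraNneq (fq0 j js) => Pj0; rewrite -(line0 q0 q1) fP Pj0 horner0.
pose a (k : X * 'I_3 * bool) :=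
  if k.2 then q0 k.1.1 0 k.1.2 else 1 - q0 k.1.1 0 k.1.2.
(* a k + t * b k is the distance at time t from the coordinate to 0 or to 1. *)
pose b (k : X * 'I_3 * bool) :=
  let d := (q1 k.1.1 - q0 k.1.1) 0 k.1.2 in if k.2 then d else - d.
have [|e e0 small] := @small_perturbation _ a b.
  by move=> [[v c] []]; rewrite /a /=; have := q01 v c; lra.
have [t te Qt] := small_nonroot Q0 e0.
exists (line q0 q1 t) => [v c|j js].
  have := small t te (v, c, true); have := small t te (v, c, false).
  by rewrite /a /b /= !mxE; lra.
rewrite fP; apply: contraNneq Qt => Pj0; apply/eqP.
by rewrite horner_prod; apply/eqP; rewrite prodf_seq_eq0; apply/hasP; exists j; rewrite ?Pj0 /=.
Qed.

End PolynomialOnLines.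

(** * Cross products and the axes of a gain space *)

Section Cross.
Variable T : comRingType.
Implicit Types a b c w : 'rV[T]_3.

Definition cross a b : 'rV[T]_3 :=
  \row_k [:: a 0 1 * b 0 2%:R - a 0 2%:R * b 0 1;
             a 0 2%:R * b 0 0 - a 0 0 * b 0 2%:R;
             a 0 0 * b 0 1 - a 0 1 * b 0 0]`_k.

Lemma ord3_ind (P : 'I_3 -> Prop) : P 0 -> P 1 -> P 2%:R -> forall k, P k.
Proof.
move=> P0 P1 P2 [[|[|[|//]]] lt3].
- by rewrite (_ : Ordinal lt3 = 0) //; apply: val_inj.
- by rewrite (_ : Ordinal lt3 = 1) //; apply: val_inj.
- by rewrite (_ : Ordinal lt3 = 2%:R) //; apply: val_inj.
Qed.

Lemma sum3 (V : nmodType) (f : 'I_3 -> V) :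
  \sum_k f k = f 0 + f 1 + f 2%:R.
Proof.
rewrite !big_ord_recl big_ord0 addr0 addrA.
by congr (_ + f _ + f _); apply: val_inj.
Qed.

Lemma cross0E a b : cross a b 0 0 = a 0 1 * b 0 2%:R - a 0 2%:R * b 0 1.
Proof. by rewrite mxE. Qed.
Lemma cross1E a b : cross a b 0 1 = a 0 2%:R * b 0 0 - a 0 0 * b 0 2%:R.
Proof. by rewrite mxE. Qed.
Lemma cross2E a b : cross a b 0 2%:R = a 0 0 * b 0 1 - a 0 1 * b 0 0.
Proof. by rewrite mxE. Qed.
Definition crossE := (cross0E, cross1E, cross2E).

Lemma crossDl a b c : cross (a + b) c = cross a c + cross b c.
Proof.
by apply/rowP; apply: ord3_ind; rewrite !(mxE, crossE) /=; ring.
Qed.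

Lemma crossNl a b : cross (- a) b = - cross a b.
Proof.
by apply/rowP; apply: ord3_ind; rewrite !(mxE, crossE) /=; ring.
Qed.

Lemma crossZl k a b : cross (k *: a) b = k *: cross a b.
Proof.
by apply/rowP; apply: ord3_ind; rewrite !(mxE, crossE) /=; ring.
Qed.

Lemma crossZr k a b : cross a (k *: b) = k *: cross a b.
Proof.
by apply/rowP; apply: ord3_ind; rewrite !(mxE, crossE) /=; ring.
Qed.

Lemma cross_anti a b : cross a b = - cross b a.
Proof.
by apply/rowP; apply: ord3_ind; rewrite !(mxE, crossE) /=; ring.
Qed.

Lemma crossvv a : cross a a = 0.
Proof.
by apply/rowP; apply: ord3_ind; rewrite !(mxE, crossE) /=; ring.
Qed.

Lemma cross0l b : cross 0 b = 0.
Proof. by have := crossZl 0 0 b; rewrite !scale0r. Qed.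

Lemma crossBl a b c : cross (a - b) c = cross a c - cross b c.
Proof. by rewrite crossDl crossNl. Qed.

Lemma cross_parallel a b k : cross a b = 0 -> b 0 k *: a = a 0 k *: b.
Proof.
move=> /rowP ab0.
have := ab0 0; have := ab0 1; have := ab0 2%:R.
rewrite !crossE !mxE => /subr0_eq E2 /subr0_eq E1 /subr0_eq E0.
apply/rowP=> l; rewrite !mxE; move: k l.
by apply: ord3_ind; apply: ord3_ind; rewrite [LHS]mulrC.
Qed.

End Cross.

Lemma map_cross (S T : comRingType) (f : {rmorphism S -> T}) (a b : 'rV[S]_3) :
  map_mx f (cross a b) = cross (map_mx f a) (map_mx f b).
Proof.
by apply/rowP; apply: ord3_ind; rewrite mxE !crossE !mxE rmorphB !rmorphM.
Qed.

Lemma row_coord_neq0 (T : nmodType) n (z : 'rV[T]_n) : z != 0 -> exists k, z 0 k != 0.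
Proof.
move=> z0; apply/existsP; apply: contraR z0 => /existsPn z0; apply/eqP/rowP=> k.
by rewrite mxE; apply/eqP/negPn/z0.
Qed.

(** A nonzero w would make both a and b multiples of w, hence parallel. *)
Lemma cross_common (F : fieldType) (a b w : 'rV[F]_3) :
  cross a w = 0 -> cross b w = 0 -> cross a b != 0 -> w = 0.
Proof.
move=> aw bw; apply: contraNeq => w0.
have [k wk] := row_coord_neq0 w0.
have: w 0 k *: (w 0 k *: cross a b) = 0.
  rewrite -crossZr -crossZl (cross_parallel k aw) (cross_parallel k bw).
  by rewrite crossZl crossZr crossvv !scaler0.
by move/eqP; rewrite !scaler_eq0 (negPf wk).
Qed.

Section Axes.
Variables (H : gain_graph) (Y : {set edge H}).
Implicit Types z : 'rV[int]_3.

Lemma gain_rank_witness : exists b : 'M[int]_(gain_rank Y, 3),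
  (forall i, gain_space Y (row i b)) /\ Z_independent b.
Proof.
rewrite /gain_rank; set P := (X in (\max_(k < 4 | X k) k)%N).
have [|k Pk ->] := @eq_bigmax_cond _ (fun k : 'I_4 => P k) (fun k : 'I_4 => k : nat).
  apply/card_gt0P; exists ord0; rewrite unfold_in; apply/asboolP.
  by exists 0; split=> [[]//|a _]; apply/rowP=> [[]].
exact/asboolP.
Qed.

Lemma gain_rank_max k (b : 'M[int]_(k, 3)) : (k < 4)%N ->
  (forall i, gain_space Y (row i b)) -> Z_independent b -> (k <= gain_rank Y)%N.
Proof.
move=> k4 bY ind; rewrite /gain_rank.
apply: (@leq_bigmax_cond _ _ (fun k : 'I_4 => k : nat) (Ordinal k4)).
by apply/asboolP; exists b.
Qed.

Lemma gain_rank_leq3 : (gain_rank Y <= 3)%N.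
Proof. by apply/bigmax_leqP=> k _; rewrite -ltnS. Qed.

Lemma Z_independent_row k (b : 'M[int]_(k, 3)) i : Z_independent b -> row i b != 0.
Proof.
move=> ind; apply/eqP=> bi0.
have /ind/rowP/(_ i) : (delta_mx 0 i : 'rV_k) *m b = 0 by rewrite -rowE.
by rewrite !mxE !eqxx.
Qed.

(** If the two rows were parallel, [cross_parallel] would write an explicit
    integral dependency between them. *)
Lemma Z_independent_cross k (b : 'M[int]_(k, 3)) i j : Z_independent b ->
  i != j -> cross (row i b) (row j b) != 0.
Proof.
move=> ind ij; apply/eqP=> c0.
have [l bl] := row_coord_neq0 (Z_independent_row i ind).
have: (row j b 0 l *: delta_mx 0 i - row i b 0 l *: delta_mx 0 j : 'rV_k) *m b = 0.
  by rewrite mulmxBl -!scalemxAl -!rowE (cross_parallel l c0) subrr.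
move/ind/rowP/(_ j); rewrite !mxE !eqxx eq_sym (negPf ij) /= mulr0 mulr1 sub0r.
by move/eqP; rewrite oppr_eq0; move: bl; rewrite mxE => /negPf->.
Qed.

Lemma gain_rank0 z : gain_rank Y = 0%N -> gain_space Y z -> z = 0.
Proof.
move=> r0 zY; apply: contrapT => /eqP z0.
have : (1 <= gain_rank Y)%N; last by rewrite r0.
apply: (@gain_rank_max 1 z) => // [i|a].
  by rewrite (_ : row i z = z) //; apply/rowP=> k; rewrite mxE ord1.
move=> az; have [k zk] := row_coord_neq0 z0.
apply/rowP=> i; move/matrixP/(_ 0 k): az; rewrite !mxE big_ord1 !ord1 => /eqP.
by rewrite mulf_eq0 (negPf zk) orbF => /eqP.
Qed.

(** Two nonparallel gains would be independent, so the rank would be at least 2. *)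
Lemma gain_rank1 z z' : gain_rank Y = 1%N -> gain_space Y z -> gain_space Y z' ->
  cross z z' = 0.
Proof.
move=> r1 zY z'Y; apply: contrapT => /eqP c0.
have : (2 <= gain_rank Y)%N; last by rewrite r1.
have R1 (x : 'rV[int]_3) (j : 'I_1) : row j x = x.
  by apply/rowP=> k; rewrite mxE ord1.
apply: (@gain_rank_max (1 + 1) (col_mx z z')) => // [i|a].
  by case: (split_ordP i) => j ->; rewrite ?rowKu ?rowKd R1.
rewrite -[a]hsubmxK mul_row_col => E.
have Z1 (x : 'rV[int]_1) (y : 'rV[int]_3) : x *m y = x 0 0 *: y.
  by rewrite [x]mx11_scalar mul_scalar_mx mxE eqxx mulr1n.
rewrite !Z1 in E.
have := congr1 (fun w => cross w z') E; have := congr1 (fun w => cross w z) E.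
rewrite !crossDl !crossZl !crossvv !cross0l !scaler0 addr0 add0r.
rewrite (cross_anti z') scalerN => b0 a0.
have [k ck] := row_coord_neq0 c0.
have {}a0 : lsubmx a 0 0 = 0.
  move/rowP/(_ k): a0; rewrite [RHS]mxE mxE => /eqP.
  by rewrite mulf_eq0 (negPf ck) orbF => /eqP.
have {}b0 : rsubmx a 0 0 = 0.
  move/rowP/(_ k): b0; rewrite [RHS]mxE mxE [X in - X]mxE => /eqP.
  by rewrite oppr_eq0 mulf_eq0 (negPf ck) orbF => /eqP.
by apply/eqP; rewrite row_mx_eq0; apply/andP; split; apply/eqP/rowP=> i;
  rewrite ord1 ?a0 ?b0 [RHS]mxE.
Qed.

Variable R : realFieldType.

(** The rotations that are unchanged when a body is transported around a cycle:
    translating by z a screw motion with rotation vector w changes its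
    translation part by the cross product of z and w. *)
Definition fixed_axis (w : 'rV[R]_3) : Prop :=
  forall z, gain_space Y z -> cross (map_mx intr z) w = 0.

(** The fixed axes form a space of dimension 3, 1 or 0 when the gain rank is 0, 1
    or at least 2, which is 3 minus the sum in the bound; C is a set of
    coordinates that parametrises it. *)
Lemma fixed_axis_coords : exists C : {set 'I_3},
  [/\ #|C|%:Z = 3 - \sum_(1 <= i < (gain_rank Y).+1) (3 - i%:Z),
      forall w, fixed_axis w -> (forall k, k \in C -> w 0 k = 0) -> w = 0
    & forall g : 'rV[R]_3,
        exists2 w, fixed_axis w & forall k, k \in C -> w 0 k = g 0 k].
Proof.
have [b [bY ind]] := gain_rank_witness; have := gain_rank_leq3.
case E: (gain_rank Y) b bY ind => [|[|r]] b bY ind r3.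
- exists setT; split.
  + by rewrite cardsT card_ord big_geq.
  + by move=> w _ w0; apply/rowP=> k; rewrite mxE w0.
  + move=> g; exists g => // z /(gain_rank0 E)->.
    by rewrite map_mx0 cross0l.
- pose z0 : 'rV[int]_3 := row 0 b; have z0Y : gain_space Y z0 := bY 0.
  have [k zk] := row_coord_neq0 (Z_independent_row 0 ind); rewrite -/z0 in zk.
  pose x0 : 'rV[R]_3 := map_mx intr z0.
  have xk : x0 0 k != 0 by rewrite mxE intr_eq0.
  exists [set k]; split.
  + by rewrite cards1 big_nat1.
  + move=> w fixw /(_ k (set11 _)) wk.
    have := cross_parallel k (fixw _ z0Y); rewrite wk scale0r => /esym/eqP.
    by rewrite scaler_eq0 (negPf xk) => /eqP.
  + move=> g; exists ((g 0 k / x0 0 k) *: x0) => [z zY|l /set1P->].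
      by rewrite crossZr -map_cross (gain_rank1 E) // map_mx0 scaler0.
    by rewrite mxE divfK.
- exists set0; split.
  + rewrite cards0; case: r {b bY ind E} r3 => [|[|//]] _.
      by rewrite unlock.
    by rewrite unlock.
  + move=> w fixw _.
    apply: cross_common (fixw _ (bY 0)) (fixw _ (bY 1)) _.
    have [k ck] := row_coord_neq0 (Z_independent_cross ind (isT : (0 : 'I_r.+2) != 1)).
    rewrite -map_cross; apply: contraNneq ck => /rowP/(_ k).
    by rewrite mxE [RHS]mxE => /eqP; rewrite intr_eq0.
  + by move=> g; exists 0 => [z _|k]; rewrite ?inE // cross_anti cross0l oppr0.
Qed.
End Axes.

(** * Walks, gains of closed walks and potentials *)

Section Walks.
Variables (H : gain_graph) (Y : {set edge H}).
Implicit Types (d : edge H * bool) (c : seq (edge H * bool)) (u v w : vert H).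

Fixpoint walk v c w : bool :=
  if c is d :: c' then [&& d.1 \in Y, dart_tail d == v & walk (dart_head d) c' w]
  else v == w.

Lemma walk_cat v c1 c2 w :
  walk v (c1 ++ c2) w <-> exists2 u, walk v c1 u & walk u c2 w.
Proof.
elim: c1 v => [|d c1 IHc] v /=.
  by split=> [?|[u /eqP->//]]; exists v.
split=> [/and3P[dY dv /IHc[u ? ?]]|[u /and3P[dY dv ?] ?]].
  by exists u; rewrite ?dY ?dv.
by rewrite dY dv /=; apply/IHc; exists u.
Qed.

Definition dart_rev d := (d.1, ~~ d.2).

Lemma walk_rev v c w : walk v c w -> walk w (rev (map dart_rev c)) v.
Proof.
elim: c v => [|d c IHc] v /=; first by rewrite eq_sym.
case/and3P=> dY /eqP <- /IHc cw; rewrite rev_cons -cats1.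
apply/walk_cat; exists (dart_head d) => //=; rewrite dY /=.
by case: (d) => e []; rewrite /dart_tail /dart_head /= !eqxx.
Qed.

Lemma net_gain_cat c1 c2 : net_gain (c1 ++ c2) = net_gain c1 + net_gain c2.
Proof. exact: big_cat. Qed.

Lemma net_gain_cons d c : net_gain (d :: c) = dart_gain d + net_gain c.
Proof. exact: big_cons. Qed.

Lemma net_gain_rev c : net_gain (rev (map dart_rev c)) = - net_gain c.
Proof.
elim: c => [|d c IHc]; first by rewrite /net_gain !big_nil oppr0.
rewrite /= rev_cons -cats1 net_gain_cat IHc !net_gain_cons /net_gain big_nil.
by rewrite addr0 opprD addrC; congr (_ + _); case: (d) => e []; rewrite /dart_gain /= ?opprK.
Qed.

Lemma gain_space0 : gain_space Y 0.
Proof.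
by exists 0%N, (fun=> [::]), (fun=> 0); split=> [[]//|]; rewrite big_ord0.
Qed.

Lemma gain_spaceD z z' : gain_space Y z -> gain_space Y z' -> gain_space Y (z + z').
Proof.
move=> [k [c [a [cyc ->]]]] [k' [c' [a' [cyc' ->]]]].
exists (k + k')%N,
  (fun i => match split i with inl j => c j | inr j => c' j end),
  (fun i => match split i with inl j => a j | inr j => a' j end); split.
  by move=> i; case: (split i).
rewrite big_split_ord /=; congr (_ + _); apply: eq_bigr => i _.
  by rewrite (unsplitK (inl i)).
by rewrite (unsplitK (inr i)).
Qed.

Lemma gain_space_cycle c : is_cycle Y c -> gain_space Y (net_gain c).
Proof.
by move=> cyc; exists 1%N, (fun=> c), (fun=> 1); split=> //; rewrite big_ord1 scale1r.
Qed.

Lemma split_repeat (T S : eqType) (f : T -> S) (s : seq T) : ~~ uniq (map f s) ->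
  exists s1 x s2 y s3, s = s1 ++ x :: s2 ++ y :: s3 /\ f x = f y.
Proof.
elim: s => //= x s IHs; rewrite negb_and negbK.
case: (boolP (f x \in map f s)) => [/mapP[y ys fxy] _|_ /= /IHs].
  case/splitPr: ys => s2 s3; exists [::], x, s2, y, s3; split=> //.
by move=> [s1 [x' [s2 [y [s3 [-> fxy]]]]]]; exists (x :: s1), x', s2, y, s3.
Qed.

Lemma walk_path d c w : walk (dart_tail d) (d :: c) w ->
  path (fun d d' => dart_head d == dart_tail d') d c /\ dart_head (last d c) = w.
Proof.
elim: c d => [|d' c IHc] d /=; first by case/and3P=> _ _ /eqP.
case/and5P=> dY _ d'Y /eqP td' cw.
have [| -> ->] := IHc d'; first by rewrite /= d'Y eqxx.
by rewrite td' eqxx.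
Qed.

Lemma walk_all v c w : walk v c w -> all (fun d => d.1 \in Y) c.
Proof. by elim: c v => //= d c IHc v /and3P[-> _ /IHc]. Qed.

Lemma walk_start v d c w : walk v (d :: c) w -> v = dart_tail d.
Proof. by case/and3P=> _ /eqP. Qed.

(** If tails are distinct but an edge repeats, it is traversed once in each
    direction.  After a rotation the walk begins with one of these traversals,
    and distinctness of tails forces it to consist of exactly the two of them. *)
Lemma backtrack_gain v c : walk v c v -> uniq (map (@dart_tail H) c) ->
  ~~ uniq (map fst c) -> net_gain c = 0.
Proof.
move=> cv uc /split_repeat[s1 [d1 [s2 [d2 [s3 [cE d12]]]]]]; subst c.
move/walk_cat: cv => [u vs1 us].
have us' : walk u ((d1 :: s2 ++ d2 :: s3) ++ s1) u by apply/walk_cat; exists v.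
have rotE : d1 :: s2 ++ d2 :: s3 ++ s1 = (d1 :: s2 ++ d2 :: s3) ++ s1.
  by rewrite /= -catA.
have ucP : uniq (map (@dart_tail H) (d1 :: s2 ++ d2 :: s3 ++ s1)).
  by rewrite rotE map_cat uniq_catC -map_cat.
have gE : net_gain (s1 ++ d1 :: s2 ++ d2 :: s3) = net_gain (d1 :: s2 ++ d2 :: s3 ++ s1).
  by rewrite rotE !net_gain_cat addrC.
rewrite gE; have {}us' : walk u (d1 :: s2 ++ d2 :: s3 ++ s1) u.
  by rewrite rotE.
have ud1 := walk_start us'.
have ht : dart_head d1 = dart_tail d2 /\ dart_head d2 = dart_tail d1.
  have t12 : dart_tail d1 != dart_tail d2.
    apply: contraL ucP => /eqP t12; rewrite /= !map_cat /= t12.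
    by rewrite mem_cat in_cons eqxx orbT.
  case: (d1) (d2) d12 t12 => e1 [] [e2 []] /= <-;
  by rewrite /dart_tail /dart_head /= ?eqxx.
have g12 : dart_gain d1 + dart_gain d2 = 0.
  have t12 : dart_tail d1 != dart_tail d2.
    apply: contraL ucP => /eqP t12; rewrite /= !map_cat /= t12.
    by rewrite mem_cat in_cons eqxx orbT.
  case: (d1) (d2) d12 t12 => e1 [] [e2 []] /= <-;
  by rewrite /dart_tail /dart_gain /= ?eqxx // ?addNr ?subrr.
case: s2 us' ucP {us gE uc rotE} => [|x s2] us' ucP; last first.
  case/and3P: us' => _ _ /walk_start; rewrite ht.1 => xE.
  move: ucP => /= /and3P[_]; rewrite -xE map_cat mem_cat /= inE eqxx orbT.
  by [].
case: (s3 ++ s1) us' ucP => [|y s] us' ucP.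
  by rewrite /= !net_gain_cons /net_gain big_nil addr0.
case/and3P: us' => _ _ /and3P[_ _] /walk_start; rewrite ht.2 => yE.
by move: ucP; rewrite /= -yE !inE eqxx orbT.
Qed.

(** A closed walk that visits a vertex twice splits into two shorter closed walks;
    otherwise it is a cycle or a single edge traversed back and forth. *)
Lemma closed_walk_gain v c : walk v c v -> gain_space Y (net_gain c).
Proof.
have [n] := ubnP (size c); elim: n v c => // n IHn v c; rewrite ltnS => cn cv.
case: (boolP (uniq (map (@dart_tail H) c))) => [uc|]; last first.
  move=> /split_repeat[s1 [d1 [s2 [d2 [s3 [cE t12]]]]]]; subst c.
  move: cv => /walk_cat[u vs1]; rewrite -cat_cons => /walk_cat[u' us2 us3].
  have uE := walk_start us2; have u'E := walk_start us3.
  rewrite -t12 -uE in u'E; subst u'.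
  have := gain_spaceD (IHn u (d1 :: s2) _ us2) (IHn v (s1 ++ d2 :: s3) _ _).
  rewrite !net_gain_cat addrCA; apply.
  - by move: cn; rewrite !size_cat /= size_cat /=; lia.
  - by move: cn; rewrite !size_cat /= size_cat /=; lia.
  - by apply/walk_cat; exists u.
case: (boolP (uniq (map fst c))) => [uf|uf]; last first.
  by rewrite (backtrack_gain cv) //; apply: gain_space0.
case: c cv uc uf {cn} => [|d c] cv uc uf.
  by rewrite /net_gain big_nil; apply: gain_space0.
apply: gain_space_cycle; rewrite /is_cycle uc uf (walk_all cv) /= andbT.
move: (cv); rewrite (walk_start cv) => /walk_path[pc lc].
by rewrite rcons_path pc lc eqxx.
Qed.

Lemma path_walk d c : all (fun d => d.1 \in Y) (d :: c) ->
  path (fun d d' => dart_head d == dart_tail d') d c ->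
  walk (dart_tail d) (d :: c) (dart_head (last d c)).
Proof.
elim: c d => [|d' c IHc] d; first by rewrite /= andbT => -> _; rewrite !eqxx.
case/andP=> dY cY /andP[/eqP hd pc]; have := IHc d' cY pc.
by rewrite -hd /= dY eqxx.
Qed.

Lemma cycle_walk c : is_cycle Y c ->
  exists d c', c = d :: c' /\ walk (dart_tail d) c (dart_tail d).
Proof.
case: c => // d c /and5P[_ cY cyc _ _]; exists d, c; split=> //.
move: cyc; rewrite /= rcons_path => /andP[pc /eqP ld].
rewrite -[X in walk _ _ X]ld; exact: (@path_walk d c).
Qed.

Definition reach v w : bool := `[< exists c, walk v c w >].

Lemma reach_refl v : reach v v.
Proof. by apply/asboolP; exists [::] => /=. Qed.

Lemma reach_edge e v : e \in Y -> reach (src e) v = reach (dst e) v.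
Proof.
move=> eY; apply/asboolP/asboolP=> -[c cw].
  by exists ((e, true) :: c); rewrite /= eY eqxx.
by exists ((e, false) :: c); rewrite /= eY eqxx.
Qed.

(** Choose a root in each component and let psi v be the net gain of a walk from
    the root to v.  The walk out to src e, then e, then the walk back from dst e
    is closed. *)
Lemma gain_potential : exists psi : vert H -> 'rV[int]_3,
  forall e, e \in Y -> gain_space Y (psi (src e) + gain e - psi (dst e)).
Proof.
pose rep v := odflt v [pick w | reach v w].
have repP v : reach v (rep v).
  by rewrite /rep; case: pickP => // /(_ v); rewrite reach_refl.
have rep_edge e : e \in Y -> rep (src e) = rep (dst e).
  move=> eY; rewrite /rep (eq_pick (fun w => reach_edge w eY)).
  by case: pickP => // /(_ (dst e)); rewrite reach_refl.
have /choice[c cP] : forall v, exists c, walk v c (rep v) by move=> v; apply/asboolP/repP.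
exists (fun v => - net_gain (c v)) => e eY; rewrite opprK.
have -> : - net_gain (c (src e)) + gain e + net_gain (c (dst e)) =
    net_gain (rev (map dart_rev (c (src e))) ++ (e, false) :: c (dst e)).
  by rewrite net_gain_cat net_gain_rev net_gain_cons addrA.
apply: (@closed_walk_gain (rep (src e))); apply/walk_cat.
exists (src e); first exact: walk_rev.
by rewrite /= eY eqxx /= rep_edge //; apply: cP.
Qed.

End Walks.

(** * Assignments of screw motions to bodies that respect gains *)

Section Linked.
Variables (R : realFieldType) (H : gain_graph).
Implicit Types (Y : {set edge H}) (e : edge H) (v : vert H).

(** A screw motion for each body: (v, (true, k)) is the k-th coordinate of the
    rotation vector of v and (v, (false, k)) that of its translation vector. *)
Definition coord : finType := (vert H * (bool * 'I_3))%type.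
Implicit Types (x : coord -> R).

Definition gainR (z : 'rV[int]_3) : 'rV[R]_3 := map_mx intr z.

Definition part x (b : bool) v : 'rV[R]_3 := \row_k x (v, (b, k)).

(** The copy of the body [dst e] displaced by [gain e] moves with the same screw
    motion as the body [src e]. *)
Definition linked x e : Prop :=
  part x true (src e) = part x true (dst e) /\
  part x false (src e) =
    part x false (dst e) + cross (gainR (gain e)) (part x true (dst e)).

Lemma gainRD z z' : gainR (z + z') = gainR z + gainR z'.
Proof. exact: map_mxD. Qed.

Lemma gainRN z : gainR (- z) = - gainR z.
Proof. exact: map_mxN. Qed.

Lemma linked_walk Y x c v w : (forall e, e \in Y -> linked x e) ->
  walk Y v c w -> part x true v = part x true w /\
  part x false v = part x false w + cross (gainR (net_gain c)) (part x true w).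
Proof.
move=> lx; elim: c v => [|d c IHc] v /=.
  by move/eqP->; rewrite /net_gain big_nil /gainR map_mx0 cross0l addr0.
case/and3P=> dY /eqP<- /IHc[tw tt]; have [lw lt] := lx _ dY.
rewrite net_gain_cons gainRD crossDl.
case: d dY tw tt lw lt => e [] /= eY; rewrite /dart_head /dart_tail /dart_gain /= => tw tt lw lt.
  rewrite -lw tw; split=> //; move: lt; rewrite tt -lw tw gainRN crossNl => E.
  by rewrite [X in _ + X]addrC addrA E addrK.
by rewrite lw tw lt tt tw; split=> //; rewrite -addrA [X in _ + X]addrC.
Qed.

Lemma linked_closed_walk Y x c v : (forall e, e \in Y -> linked x e) ->
  walk Y v c v -> cross (gainR (net_gain c)) (part x true v) = 0.
Proof.
move=> lx /(linked_walk lx)[_] /eqP.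
by rewrite -[X in X == _]addr0 (inj_eq (addrI _)) => /eqP.
Qed.

Lemma part_eq0 x v : part x true v = 0 -> part x false v = 0 ->
  forall bk, x (v, bk) = 0.
Proof.
move=> /rowP w0 /rowP t0 [[] k]; first by have := w0 k; rewrite !mxE.
by have := t0 k; rewrite !mxE.
Qed.

(** Parameters of the motion of a root body v whose rotation vector is a fixed
    axis, when C comes from [fixed_axis_coords]. *)
Definition root_coords v (C : {set 'I_3}) : {set coord} :=
  setX [set v] (setX [set false] setT :|: setX [set true] C).

Lemma in_root_coords v C j :
  (j \in root_coords v C) = (j.1 == v) && (j.2.1 ==> (j.2.2 \in C)).
Proof. by case: j => [v' [[] k]]; rewrite !inE /= ?orbF ?andbT. Qed.

Lemma card_root_coords v C : #|root_coords v C| = (3 + #|C|)%N.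
Proof.
rewrite cardsX cards1 mul1n cardsU !cardsX !cards1 cardsT card_ord !mul1n.
rewrite (_ : _ :&: _ = set0) ?cards0 ?subn0 //.
by apply/setP=> -[[] k]; rewrite !inE.
Qed.

Definition coords_over (S : {set vert H}) : {set coord} := setX S setT.

Lemma in_coords_over S j : (j \in coords_over S) = (j.1 \in S).
Proof. by case: j => v bk; rewrite !inE andbT. Qed.

Lemma card_coords_over S : #|coords_over S| = (#|S| * 6)%N.
Proof. by rewrite cardsX cardsT card_prod card_bool card_ord. Qed.

Lemma card_coord : #|coord| = (#|vert H| * 6)%N.
Proof. by rewrite !card_prod card_bool card_ord. Qed.

Lemma mem_vertices_of Y v :
  reflect (exists2 e, e \in Y & (v == src e) || (v == dst e)) (v \in vertices_of Y).
Proof. by rewrite inE; apply: exists_inP. Qed.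

Definition bounded_at Y : Prop :=
  #|Y|%:Z <= 6 * #|vertices_of Y|%:Z - 6
                + \sum_(1 <= i < (gain_rank Y).+1) (3 - i%:Z).

(** Outside the vertices of Y nothing is constrained.  On them take a fixed axis
    w, the same for all bodies, and let a potential dictate the translation
    parts; this works for disconnected Y as well. *)
Lemma linked_free Y v0 : v0 \in vertices_of Y -> exists D : {set coord},
  #|D|%:Z = 6 * #|vert H|%:Z - (6 * #|vertices_of Y|%:Z - 6
                + \sum_(1 <= i < (gain_rank Y).+1) (3 - i%:Z)) /\
  forall g : coord -> R, exists2 x, forall e, e \in Y -> linked x e
                         & forall j, j \in D -> x j = g j.
Proof.
move=> v0Y; have [C [cardC _ freeC]] := fixed_axis_coords Y R.
have [psi psiP] := gain_potential Y.
exists (coords_over (~: vertices_of Y) :|: root_coords v0 C); split.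
  rewrite cardsU (_ : _ :&: _ = set0) ?cards0 ?subn0; last first.
    apply/setP=> j; rewrite in_setI in_coords_over in_root_coords in_setC in_set0.
    by case: (eqVneq j.1 v0) => [->|_]; rewrite ?v0Y //= ?andbF.
  rewrite card_coords_over card_root_coords; have := cardsC (vertices_of Y).
  by move: cardC; lia.
move=> g; have [w fixw wg] := freeC (part g true v0).
pose tau := part g false v0 + cross (gainR (psi v0)) w.
pose x (j : coord) : R := if j.1 \in vertices_of Y then
  if j.2.1 then w 0 j.2.2 else (tau - cross (gainR (psi j.1)) w) 0 j.2.2
  else g j.
have xw v : v \in vertices_of Y -> part x true v = w.
  by move=> vY; apply/rowP=> k; rewrite mxE /x /= vY.
have xt v : v \in vertices_of Y -> part x false v = tau - cross (gainR (psi v)) w.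
  by move=> vY; apply/rowP=> k; rewrite mxE /x /= vY.
exists x => [e eY|j].
  have sY : src e \in vertices_of Y by apply/mem_vertices_of; exists e; rewrite ?eqxx.
  have dY : dst e \in vertices_of Y by apply/mem_vertices_of; exists e; rewrite ?eqxx ?orbT.
  split; rewrite !xw // !xt //.
  have := fixw _ (psiP _ eY); rewrite -/(gainR _) !gainRD gainRN !crossDl crossNl => /subr0_eq <-.
  by rewrite opprD [X in _ = X + _]addrA addrNK.
case: j => v [b k]; rewrite in_setU in_coords_over in_root_coords in_setC /x /=.
case: (boolP (v \in vertices_of Y)) => //= vY /andP[/eqP ->].
case: b => /= kC; first by rewrite wg // mxE.
by rewrite addrK mxE.
Qed.

(** Induction on Y, splitting off the component of one edge.  Inside a component
    the motion of a root body determines all the others, and transport around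
    cycles makes its rotation vector a fixed axis, so the coordinates of the root
    that parametrise these motions can replace all the 6 coordinates of each
    vertex of the component; the bound for the component says that this
    removes at least as many coordinates as the component has edges. *)
Lemma linked_determined :
  (forall Y, Y != set0 -> bounded_at Y) ->
  forall Y, exists D : {set coord},
  [/\ (#|D| + #|Y| <= 6 * #|vert H|)%N,
      forall j, j.1 \notin vertices_of Y -> j \in D
    & forall x, (forall e, e \in Y -> linked x e) ->
        (forall j, j \in D -> x j = 0) -> forall j, x j = 0].
Proof.
move=> bound Y; have [n] := ubnP #|Y|; elim: n Y => // n IHn Y; rewrite ltnS => Yn.
case: (set_0Vmem Y) => [->|[e0 e0Y]].
  exists setT; split=> [|j _|x _ x0 j]; [|by rewrite in_setT|by apply: x0; rewrite in_setT].
  by rewrite cardsT card_coord cards0; lia.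
pose v0 := src e0; pose comp := [set e in Y | reach Y v0 (src e)].
have compY : comp \subset Y by apply/subsetP=> e; rewrite inE => /andP[].
have e0c : e0 \in comp by rewrite inE e0Y reach_refl.
have c0 : comp != set0 by apply/set0Pn; exists e0.
have reach_c v : v \in vertices_of comp -> reach Y v0 v.
  case/mem_vertices_of=> e; rewrite inE => /andP[eY re] /orP[/eqP->//|/eqP->].
  have /asboolP[c cw] := re; apply/asboolP; exists (c ++ [:: (e, false)]).
  by apply/walk_cat; exists (src e); rewrite //= eY !eqxx.
have v0c : v0 \in vertices_of comp by apply/mem_vertices_of; exists e0; rewrite ?eqxx.
have disj v : v \in vertices_of comp -> v \notin vertices_of (Y :\: comp).
  move=> vc; apply/negP=> /mem_vertices_of[e]; rewrite !inE => /andP[ec eY] ve.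
  case/negP: ec; rewrite eY /=; have /asboolP[c cw] := reach_c _ vc.
  case/orP: ve => /eqP vE; first by apply/asboolP; exists c; rewrite -vE.
  apply/asboolP; exists (c ++ [:: (e, true)]); apply/walk_cat; exists v => //=.
  by rewrite eY vE !eqxx.
have [|D' [cardD' outD' detD']] := IHn (Y :\: comp).
  move: Yn c0; rewrite -card_gt0 -(cardsID comp Y) (setIidPr compY).
  by move=> Yn c0; apply: leq_trans Yn; rewrite -add1n leq_add2r.
have [C [cardC detC _]] := fixed_axis_coords comp R.
have subD' : coords_over (vertices_of comp) \subset D'.
  by apply/subsetP=> j; rewrite in_coords_over => /disj/outD'.
exists (D' :\: coords_over (vertices_of comp) :|: root_coords v0 C); split.
- have := cardsID (coords_over (vertices_of comp)) D'.
  rewrite (setIidPr subD') card_coords_over.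
  have := cardsID comp Y; rewrite (setIidPr compY).
  have := leq_card_setU (D' :\: coords_over (vertices_of comp)) (root_coords v0 C).
  rewrite card_root_coords => -[le _].
  have := bound _ c0; rewrite /bounded_at; move: cardC cardD' le.
  by set c1 := #|_ :|: _|; set c2 := #|D' :\: _|; set s := \sum_(1 <= i < _) _; lia.
- move=> j jY; rewrite in_setU in_setD in_coords_over outD' ?andbT.
    apply/orP; left; apply: contra jY => /mem_vertices_of[e ec je].
    by apply/mem_vertices_of; exists e => //; apply: (subsetP compY).
  apply: contra jY => /mem_vertices_of[e]; rewrite inE => /andP[_ eY] je.
  by apply/mem_vertices_of; exists e.
move=> x lx x0; apply: detD' => [e|j jD'].
  by rewrite inE => /andP[_]; apply: lx.
case: (boolP (j.1 \in vertices_of comp)) => [jc|jc]; last first.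
  by apply: x0; rewrite in_setU in_setD in_coords_over jc jD'.
have t0 : part x false v0 = 0.
  by apply/rowP=> k; rewrite !mxE x0 // in_setU in_root_coords eqxx orbT.
have w0 : part x true v0 = 0.
  apply: detC => [z [k [c [a [cyc ->]]]]|k kC]; last first.
    by rewrite mxE x0 // in_setU in_root_coords eqxx kC orbT.
  rewrite -/(gainR _) /gainR raddf_sum /=.
  have cross_sum (f : 'I_k -> 'rV[R]_3) w :
      cross (\sum_(i < k) f i) w = \sum_(i < k) cross (f i) w.
    by apply: (big_morph (fun y => cross y w)) => [y y'|]; rewrite ?crossDl ?cross0l.
  rewrite cross_sum big1 // => i _; rewrite map_mxZ crossZl.
  have [d [c' [cE cw]]] := cycle_walk (cyc i).
  have dc : d.1 \in comp by have /and5P[_ /allP/(_ d)] := cyc i; rewrite cE mem_head => /(_ isT).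
  have vc : dart_tail d \in vertices_of comp.
    by apply/mem_vertices_of; exists d.1 => //; case: (d) => e [] /=; rewrite eqxx ?orbT.
  have /asboolP[c0' /(linked_walk lx)[-> _]] := reach_c _ vc.
  rewrite (linked_closed_walk _ cw) ?scaler0 // => e ec.
  by apply: lx; apply: (subsetP compY).
have /asboolP[c cw] := reach_c _ jc.
have [wE tE] := linked_walk lx cw.
have wj : part x true j.1 = 0 by rewrite -wE.
move: tE; rewrite wj t0 cross_anti cross0l oppr0 addr0 => /esym tj.
by case: j wj tj {jD' jc cw wE} => v bk /= wj tj; apply: part_eq0.
Qed.

End Linked.

(** * Rigidity matrices and generic positions of bar-joint frameworks *)

Lemma poly_on_lines_cross (R : realFieldType) (X : finType)
    (u v : (X -> 'rV[R]_3) -> 'rV[R]_3) :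
  (forall k, poly_on_lines (fun p => u p 0 k)) ->
  (forall k, poly_on_lines (fun p => v p 0 k)) ->
  forall k, poly_on_lines (fun p => cross (u p) (v p) 0 k).
Proof.
move=> pu pv; apply: ord3_ind.
- rewrite (_ : (fun p => _) = fun p => u p 0 1 * v p 0 2%:R - u p 0 2%:R * v p 0 1).
    by apply: poly_on_linesB; apply: poly_on_linesM.
  by apply/funext=> p; rewrite crossE.
- rewrite (_ : (fun p => _) = fun p => u p 0 2%:R * v p 0 0 - u p 0 0 * v p 0 2%:R).
    by apply: poly_on_linesB; apply: poly_on_linesM.
  by apply/funext=> p; rewrite crossE.
- rewrite (_ : (fun p => _) = fun p => u p 0 0 * v p 0 1 - u p 0 1 * v p 0 0).
    by apply: poly_on_linesB; apply: poly_on_linesM.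
  by apply/funext=> p; rewrite crossE.
Qed.

Lemma poly_on_lines_diff (R : realFieldType) (X : finType) (v w : X) k :
  poly_on_lines (fun p : X -> 'rV[R]_3 => (p v - p w) 0 k).
Proof.
rewrite (_ : (fun p => _) = fun p : X -> 'rV[R]_3 => p v 0 k - p w 0 k).
  by apply: poly_on_linesB; apply: poly_on_lines_coord.
by apply/funext=> p; rewrite !mxE.
Qed.

Lemma sum_pair (V : nmodType) (A B : finType) (f : A * B -> V) :
  \sum_j f j = \sum_a \sum_b f (a, b).
Proof. by rewrite pair_bigA; apply: eq_bigr => -[a b]. Qed.

Section BarJointRigidity.
Variables (R : realType) (G : gain_graph).
Implicit Types (p q u : vert G -> 'rV[R]_3).

Definition joint_coord : finType := (vert G * 'I_3)%type.

Definition rig_coef p (e : edge G) (j : joint_coord) : R :=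
  ((j.1 == src e)%:R - (j.1 == dst e)%:R) * bar_vector p e 0 j.2.

Definition velocity_of (x : joint_coord -> R) (v : vert G) : 'rV[R]_3 :=
  \row_k x (v, k).

Lemma rig_coef_sum p e (x : joint_coord -> R) :
  \sum_j rig_coef p e j * x j =
  dot (velocity_of x (src e) - velocity_of x (dst e)) (bar_vector p e).
Proof.
rewrite sum_pair exchange_big /=.
apply: eq_bigr => k _.
have -> : (velocity_of x (src e) - velocity_of x (dst e)) 0 k = x (src e, k) - x (dst e, k).
  by rewrite !mxE.
rewrite /rig_coef /=.
have pick v : \sum_w (w == v)%:R * bar_vector p e 0 k * x (w, k) = bar_vector p e 0 k * x (v, k).
  rewrite (bigD1 v) //= eqxx mul1r big1 ?addr0 // => w /negPf->.
  by rewrite !mul0r.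
under eq_bigr => w _ do rewrite mulrBl mulrBl.
by rewrite sumrB !pick -mulrBr mulrC.
Qed.

Lemma rig_rk p : rk (rig_coef p) setT = \rank (rigidity_matrix p).
Proof. exact: rk_setT. Qed.

Definition at_joint (v : vert G) : {set joint_coord} := setX [set v] setT.

Lemma card_at_joint v : #|at_joint v| = 3%N.
Proof. by rewrite cardsX cards1 cardsT card_ord. Qed.

Lemma rig_free p v : free_on (rig_coef p) setT (at_joint v).
Proof.
move=> g; pose x (j : joint_coord) := g (v, j.2).
exists x => [e _|[w k]]; last by rewrite in_setX => /andP[/set1P->].
have E : velocity_of x (src e) = velocity_of x (dst e) by apply/rowP=> k; rewrite !mxE.
by rewrite rig_coef_sum E subrr /dot big1 // => k _; rewrite mxE mul0r.
Qed.

(** Translations realise every velocity at v, so rigidity means that a motion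
    fixing v vanishes. *)
Lemma inf_rigid_rank p (v : vert G) :
  inf_rigid_torus p <-> (#|joint_coord| <= \rank (rigidity_matrix p) + 3)%N.
Proof.
rewrite -rig_rk -(card_at_joint v); split=> [rigid|rk_p u mot].
  apply: determined_rk => x sol x0 [w k].
  have [e|t tE] := rigid (velocity_of x); first by rewrite -rig_coef_sum sol.
  have := tE w; rewrite -(tE v) => /rowP/(_ k); rewrite !mxE => ->.
  by apply: x0; rewrite in_setX !inE /= eqxx.
have det := free_determined (@rig_free p v) rk_p.
exists (u v) => w; apply/rowP=> k.
pose x (j : joint_coord) := u j.1 0 j.2 - u v 0 j.2.
suff : x (w, k) = 0 by move/eqP; rewrite subr_eq0 => /eqP.
apply: (det x) => [e _|[w' l]]; last by rewrite in_setX /x /= => /andP[/set1P-> _]; rewrite subrr.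
rewrite rig_coef_sum -[RHS](mot e); congr dot.
by apply/rowP=> l; rewrite !mxE /x /=; ring.
Qed.

(** A largest nonzero minor at q is not identically zero, so it is nonzero at p. *)
Lemma generic_max_rank p q :
  generic p -> (\rank (rigidity_matrix q) <= \rank (rigidity_matrix p))%N.
Proof.
move=> gen; have [f [g fg]] := minor_of_rank (leqnn (\rank (rigidity_matrix q))).
by apply: (rank_of_minor (f := f) (g := g)); apply: gen; exists q.
Qed.

Lemma poly_on_lines_bar e k : poly_on_lines (fun p => bar_vector p e 0 k).
Proof.
rewrite (_ : (fun p => _) = fun p => p (src e) 0 k - p (dst e) 0 k - (gain e 0 k)%:~R).
  by do 2?apply: poly_on_linesB; [exact: poly_on_lines_coord..|exact: poly_on_lines_const].
by apply/funext=> p; rewrite !mxE.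
Qed.

Lemma poly_on_lines_minor k (f : 'I_k -> 'I_#|edge G|)
    (g : 'I_k -> 'I_#|{: vert G * 'I_3}|) :
  poly_on_lines (fun p => \det (mxsub f g (rigidity_matrix p))).
Proof.
apply: poly_on_lines_det => i j.
rewrite (_ : (fun p => _) = fun p => rig_coef p (enum_val (f i)) (enum_val (g j))).
  by apply: poly_on_linesM; [exact: poly_on_lines_const|exact: poly_on_lines_bar].
by apply/funext=> p; rewrite !mxE.
Qed.

(** Only finitely many minors matter, since one with a repeated row vanishes
    identically.  The extra functions f impose further nonvanishing
    conditions on the generic position. *)
Lemma exists_generic (I : finType) (f : I -> (vert G -> 'rV[R]_3) -> R) :
  (forall i, poly_on_lines (f i)) -> (forall i, exists q, f i q != 0) ->
  exists q : vert G -> 'rV[R]_3,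
    [/\ forall v c, 0 < q v 0 c < 1, generic q & forall i, f i q != 0].
Proof.
move=> pf fn0; pose m := #|edge G|; pose n := #|{: vert G * 'I_3}|.
pose M := {k : 'I_m.+1 & {ffun 'I_k -> 'I_m} * {ffun 'I_k -> 'I_n}}%type.
pose minor (z : M) (p : vert G -> 'rV[R]_3) :=
  \det (mxsub (tagged z).1 (tagged z).2 (rigidity_matrix p)).
(* A minor that vanishes identically imposes no condition and is replaced by 1. *)
pose h (z : I + M) p := match z with
  | inl i => f i p
  | inr z => if `[< exists q, minor z q != 0 >] then minor z p else 1 end.
have [|[i|z]|q q01 hq] := @common_nonvanishing R (vert G) (I + M)%type h.
- case=> [i|z]; first exact: pf.
  rewrite /h; case: asboolP => _; last exact: poly_on_lines_const.
  exact: poly_on_lines_minor.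
- exact: fn0.
- rewrite /h; case: asboolP => // _; exists (fun=> 0); exact: oner_neq0.
exists q; split=> // [k a b [q' q'n0]|i]; last exact: (hq (inl i)).
have a_inj : injective a.
  move=> i j aij; apply: contraNeq q'n0 => ij; apply/eqP.
  by apply: (determinant_alternate ij) => l; rewrite !mxE aij.
have km : (k < m.+1)%N.
  by rewrite ltnS /m; have := leq_card a a_inj; rewrite !card_ord.
have E p : minor (Tagged (fun k : 'I_m.+1 => ({ffun 'I_k -> 'I_m} * {ffun 'I_k -> 'I_n})%type)
    (([ffun i => a i], [ffun i => b i]) : {ffun 'I_(Ordinal km) -> _} * _)) p =
    \det (mxsub a b (rigidity_matrix p)).
  by congr (\det _); apply/matrixP=> i j; rewrite !mxE !ffunE.
have := hq (inr (Tagged (fun k : 'I_m.+1 => ({ffun 'I_k -> 'I_m} * {ffun 'I_k -> 'I_n})%type)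
    (([ffun i => a i], [ffun i => b i]) : {ffun 'I_(Ordinal km) -> _} * _))).
rewrite /h; case: asboolP => [_|[]]; first by rewrite E.
by exists q'; rewrite E.
Qed.

End BarJointRigidity.

(** The row of a loop with gain 0 is zero, so deleting the loop changes neither
    the generic positions nor their motions, against minimality. *)
Lemma isostatic_loopless (R : realType) (G : gain_graph) (e : edge G) :
  isostatic R G -> src e != dst e.
Proof.
case=> gain0 rigid minimal; apply/negP=> /eqP loop.
apply: (minimal e) => p gen u mot; apply: (rigid p); last first.
  move=> e'; case: (eqVneq e' e) => [->|ne]; last first.
    exact: (mot (Sub e' ne : edge (delete_edge e))).
  by rewrite loop subrr /dot big1 // => k _; rewrite mxE mul0r.
have bar0 q : bar_vector q e = 0.
  by rewrite /bar_vector loop gain0 subrr map_mx0 subr0.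
move=> k f g [q qn0].
have fe i : enum_val (f i) != e.
  apply: contraNneq qn0 => fie; apply/eqP.
  rewrite (expand_det_row _ i) big1 // => j _.
  by rewrite 2!mxE /= fie bar0 mxE mulr0 mul0r.
pose f' i : 'I_#|edge (delete_edge e)| :=
  enum_rank (Sub (enum_val (f i)) (fe i) : edge (delete_edge e)).
have E q' : mxsub f g (rigidity_matrix q') =
    mxsub f' g (rigidity_matrix (q' : vert (delete_edge e) -> _)).
  by apply/matrixP=> i j; rewrite !mxE enum_rankK.
by rewrite E; apply: gen; exists q; rewrite -E.
Qed.

Lemma skew_cross (R : realFieldType) (S : 'M[R]_3) : S^T = - S ->
  exists w, forall p : 'rV_3, p *m S = cross w p.
Proof.
move=> skew; have sk i j : S j i = - S i j.
  by have /matrixP/(_ i j) := skew; rewrite !mxE.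
have diag i : S i i = 0 by have := sk i i; lra.
pose w : 'rV[R]_3 := \row_k [:: S 1 2%:R; S 2%:R 0; S 0 1]`_k.
exists w => p; apply/rowP; apply: ord3_ind;
  rewrite !crossE mxE sum3 !mxE /= ?diag.
- by rewrite (sk 0 2%:R) (sk 0 1); ring.
- by rewrite (sk 1 2%:R); ring.
- by rewrite (sk 2%:R 0); ring.
Qed.

(** * Body-bar frameworks *)

Section BodyBarRigidity.
Variables (R : realType) (H : gain_graph).
Implicit Types (x : coord H -> R) (P Q d : 'rV[R]_3) (e : edge H).

Definition velocity x (v : vert H) P : 'rV[R]_3 :=
  cross (part x true v) P + part x false v.

(** The row of a bar e with direction d whose ends are at P on [src e] and at Q on
    [dst e]: the Pluecker vectors of the lines through P and through Q. *)
Definition bar_coef e P Q d (j : coord H) : R :=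
  (j.1 == src e)%:R * (if j.2.1 then cross P d else d) 0 j.2.2
  - (j.1 == dst e)%:R * (if j.2.1 then cross Q d else d) 0 j.2.2.

Lemma dotBl (a b c : 'rV[R]_3) : dot (a - b) c = dot a c - dot b c.
Proof. by rewrite /dot !sum3 !mxE; ring. Qed.

Lemma dot_cross x v P d : dot (velocity x v P) d =
  \sum_bk (if bk.1 then cross P d else d) 0 bk.2 * x (v, bk).
Proof.
rewrite sum_pair big_bool /= /dot !sum3 /velocity.
by rewrite !(mxE, crossE) /=; ring.
Qed.

Lemma bar_coef_sum e P Q d x : \sum_j bar_coef e P Q d j * x j =
  dot (velocity x (src e) P - velocity x (dst e) Q) d.
Proof.
rewrite sum_pair exchange_big dotBl !dot_cross -sumrB /=; apply: eq_bigr => bk _.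
have pick (c : R) v : \sum_w (w == v)%:R * c * x (w, bk) = c * x (v, bk).
  rewrite (bigD1 v) //= eqxx mul1r big1 ?addr0 // => w /negPf->.
  by rewrite !mul0r.
by under eq_bigr => w _ do rewrite /bar_coef /= mulrBl; rewrite sumrB !pick.
Qed.

(** The lines indexed by (false, k) pass through the origin in direction k, those
    indexed by (true, k) have direction k and pass through the unit point of the
    next axis.  Their six Pluecker vectors [(cross P d, d)] are independent. *)
Definition line_point (bk : bool * 'I_3) : 'rV[R]_3 :=
  if bk.1 then delta_mx 0 (bk.2 + 1) else 0.
Definition line_dir (bk : bool * 'I_3) : 'rV[R]_3 := delta_mx 0 bk.2.
Definition line_end e bk : 'rV[R]_3 := line_point bk - line_dir bk - gainR R (gain e).

Definition line_coef (z : edge H * (bool * 'I_3)) : coord H -> R :=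
  bar_coef z.1 (line_point z.2) (line_end z.1 z.2) (line_dir z.2).

Lemma dot_dir a (bk : bool * 'I_3) : dot a (line_dir bk) = a 0 bk.2.
Proof.
rewrite /dot (bigD1 bk.2) //= mxE !eqxx mulr1 big1 ?addr0 // => k kb.
by rewrite mxE (negPf kb) andbF mulr0.
Qed.

(** The equations of the lines through the origin give the relation between the
    translation parts; the other three then give equality of the rotations. *)
Lemma line_coef_linked x e :
  (forall bk, \sum_j line_coef (e, bk) j * x j = 0) -> linked x e.
Proof.
move=> sol.
set ws := part x true (src e); set wd := part x true (dst e).
set ts := part x false (src e); set td := part x false (dst e).
pose m := gainR R (gain e).
have eq_bar bk : (cross (ws - wd) (line_point bk) + cross wd (line_dir bk)
    + (ts - (td + cross m wd))) 0 bk.2 = 0.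
  rewrite -dot_dir -[RHS](sol bk) bar_coef_sum; congr dot.
  rewrite /velocity /line_end -/m -/ws -/wd -/ts -/td.
  by apply/rowP; apply: ord3_ind; rewrite !(mxE, crossE) /=; ring.
have cdir (a : 'rV[R]_3) bk : cross a (line_dir bk) 0 bk.2 = 0.
  by case: bk => b; apply: ord3_ind; rewrite !(mxE, crossE) /=; ring.
have ts_eq : ts = td + cross m wd.
  apply/eqP; rewrite -subr_eq0; apply/eqP/rowP=> k; have := eq_bar (false, k).
  by rewrite mxE [X in X + _]mxE cdir addr0 cross_anti /line_point /=
             cross0l oppr0 [X in X + _]mxE add0r => ->; rewrite mxE.
split=> //; apply/eqP; rewrite -subr_eq0; apply/eqP.
have cpt k : cross (ws - wd) (line_point (true, k)) 0 k = 0.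
  have := eq_bar (true, k).
  by rewrite mxE [X in X + _]mxE cdir addr0 ts_eq subrr [X in _ + X]mxE addr0.
have := cpt 0; have := cpt 1; have := cpt 2%:R.
rewrite !crossE /line_point /=; move: (ws - wd) => a.
rewrite !mxE /= => E2 E1 E0.
by apply/rowP; apply: ord3_ind; rewrite [RHS]mxE; lra.
Qed.

Lemma rk_imset (I I' J : finType) (a : I -> J -> R) (f : I' -> I) :
  (rk a [set f i | i : I'] <= rk (fun i => a (f i)) setT)%N.
Proof.
apply: mxrankS; apply/sumsmx_subP=> i /imsetP[i' _ ->].
by apply: (sumsmx_sup i').
Qed.

(** By [linked_determined] the six rows over each edge of F, taken together, have
    rank at least |F|, which is the hypothesis of Rado's theorem. *)
Lemma special_lines : (forall Y, Y != set0 -> @bounded_at H Y) ->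
  exists s : edge H -> bool * 'I_3,
    (#|edge H| <= rk (fun e => line_coef (e, s e)) setT)%N.
Proof.
move=> bound.
have [|s ss] := @rado _ _ (rk line_coef) (rk0 _) (rkS _) (rk_submod _) setT; last first.
  by exists s; apply: leq_trans ss (rk_imset _ _).
move=> F.
have [D [cardD _ detD]] := linked_determined R bound F.
have := @determined_rk _ _ _ line_coef (over setT F) D.
rewrite card_coord => rkF; rewrite -(leq_add2r #|D|).
apply: leq_trans (rkF _); first by rewrite addnC mulnC.
move=> x sol x0; apply: detD => // e eF; apply: line_coef_linked => bk.
by apply: sol; rewrite !inE.
Qed.

End BodyBarRigidity.

Section InducedFramework.
Variables (R : realType) (H : gain_graph) (B : body_choice R H).
Let G := induced_graph B.
Implicit Types (p q u : vert G -> 'rV[R]_3) (x : coord H -> R) (e : edge H).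

Definition src_joint e : vert G := joint_of (bar_src B e).
Definition dst_joint e : vert G := joint_of (bar_dst B e).

Definition body_bar_coef p e : coord H -> R :=
  bar_coef e (p (src_joint e)) (p (dst_joint e)) (@bar_vector R G p (inr e)).

Definition body_motion p x : vert G -> 'rV[R]_3 := fun v => velocity x (tag v) (p v).

Lemma body_bar_coef_sum p e x : \sum_j body_bar_coef p e j * x j =
  dot (body_motion p x (src_joint e) - body_motion p x (dst_joint e))
      (@bar_vector R G p (inr e)).
Proof. exact: bar_coef_sum. Qed.

Lemma body_motion_infinitesimal p x :
  solves (body_bar_coef p) setT x -> infinitesimal_motion p (body_motion p x).
Proof.
move=> sol [[a b]|e]; last by rewrite -[RHS](sol e) // body_bar_coef_sum.
rewrite /body_motion /bar_vector /= map_mx0 subr0 /velocity /dot sum3.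
by rewrite !(mxE, crossE) /=; ring.
Qed.

Definition trans_coords (v : vert H) : {set coord H} := root_coords v set0.

(** Composition of all motions with the translation by -t. *)
Definition shift (t : 'rV[R]_3) x : coord H -> R :=
  fun j => if j.2.1 then x j else x j - t 0 j.2.2.

Lemma velocity_shift t x v P : velocity (shift t x) v P = velocity x v P - t.
Proof. by apply/rowP; apply: ord3_ind; rewrite !(mxE, crossE) /shift /=; ring. Qed.

Lemma solves_shift p t x :
  solves (body_bar_coef p) setT x -> solves (body_bar_coef p) setT (shift t x).
Proof.
move=> sol e _; rewrite -[RHS](sol e) // !body_bar_coef_sum; congr dot.
by rewrite /body_motion !velocity_shift; apply/rowP=> k; rewrite !mxE; ring.
Qed.

Lemma body_bar_free p v : free_on (body_bar_coef p) setT (trans_coords v).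
Proof.
move=> g; exists (shift (- part g false v) (fun=> 0)) => [|j].
  by apply: solves_shift => e _; rewrite big1 // => j _; rewrite mulr0.
rewrite in_root_coords; case: j => w [[] k] /=; rewrite ?inE ?andbF // => /andP[/eqP-> _].
by rewrite /shift /= !mxE; ring.
Qed.

Lemma joint_of_inj a : injective (@joint_of R H B a).
Proof. by move=> i j /eqP; rewrite /joint_of eq_Tagged => /eqP. Qed.

(** The rows of the edges of a body are zero outside the columns of its own
    joints, so a minor of the body is a minor of the whole framework. *)
Lemma generic_body p a : generic p -> @generic R (body B a) (fun i => p (joint_of i)).
Proof.
move=> gen k f g [q qn0].
have [gain0 _ _] := body_isostatic B a.
have [j0 _] : exists j0 : vert (body B a), true.
  by have /card_gt0P[j0] := ltn_trans (ltn0Sn 1) (body_card B a); exists j0.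
pose f' i : 'I_#|edge G| :=
  enum_rank (inl (Tagged (fun a => edge (body B a)) (enum_val (f i))) : edge G).
pose g' j : 'I_#|{: vert G * 'I_3}| :=
  enum_rank (joint_of (enum_val (g j)).1 : vert G, (enum_val (g j)).2).
have E q' : mxsub f' g' (rigidity_matrix (q' : vert G -> 'rV[R]_3)) =
    mxsub f g (@rigidity_matrix R (body B a) (fun i => q' (joint_of i))).
  apply/matrixP=> i j; rewrite mxE [LHS]mxE [RHS]mxE [RHS]mxE !enum_rankK /=.
  by rewrite /bar_vector /= gain0 !(inj_eq (@joint_of_inj a)).
rewrite -E; apply: gen.
exists (fun v => q (tagged_as (joint_of j0) v)); rewrite E.
by congr (\det (mxsub _ _ (rigidity_matrix _)) != 0): qn0; apply/funext=> i; rewrite tagged_asE.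
Qed.

(** Each body is rigid at a generic position, and a skew matrix acts as the cross
    product with a vector. *)
Lemma generic_bodies_rigid p u : generic p -> infinitesimal_motion p u ->
  exists x, u = body_motion p x.
Proof.
move=> gen mot.
have /choice[wt wtP] : forall a, exists wt : 'rV[R]_3 * 'rV[R]_3,
    forall i : vert (body B a), u (joint_of i) = cross wt.1 (p (joint_of i)) + wt.2.
  move=> a; have [gain0 rigid _] := body_isostatic B a.
  have [|t [S [/skew_cross[w wS] uS]]] :=
    rigid _ (generic_body (a := a) gen) (fun i => u (joint_of i)).
    move=> b; rewrite -[RHS](mot (inl (Tagged (fun a => edge (body B a)) b))).
    by rewrite /bar_vector /= gain0.
  by exists (w, t) => i; rewrite uS wS.
exists (fun j => (if j.2.1 then (wt j.1).1 else (wt j.1).2) 0 j.2.2).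
apply/funext=> -[a i]; rewrite -[RHS]/(velocity _ a (p (joint_of i))) -[LHS]/(u (joint_of i)) wtP.
by congr (cross _ _ + _); apply/rowP=> k; rewrite mxE.
Qed.

(** Subtracting the translation part of the motion of v reduces to solutions that
    vanish on the translation coordinates of v. *)
Lemma generic_inf_rigid p (v : vert H) : generic p ->
  (#|coord H| <= rk (body_bar_coef p) setT + 3)%N -> inf_rigid_torus p.
Proof.
move=> gen rk_p u mot; have [x uE] := generic_bodies_rigid gen mot; subst u.
have sol : solves (body_bar_coef p) setT x.
  by move=> e _; rewrite body_bar_coef_sum; apply: (mot (inr e)).
have := free_determined (@body_bar_free p v).
rewrite card_root_coords cards0 => /(_ rk_p) det.
pose t := part x false v; have x0 := det _ (solves_shift t sol).
exists t => w; apply/eqP; rewrite -subr_eq0 -velocity_shift; apply/eqP.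
have {}x0 j : shift t x j = 0.
  apply: x0 => -[w' [[] k]]; rewrite in_root_coords /= ?inE ?andbF // => /andP[/eqP-> _].
  by rewrite /shift /t /= mxE subrr.
have part0 b : part (shift t x) b (tag w) = 0 by apply/rowP=> k; rewrite !mxE x0.
by rewrite /velocity !part0 cross0l addr0.
Qed.

Lemma bar_end_src e : bar_end B (e, false) = src_joint e.
Proof. by []. Qed.
Lemma bar_end_dst e : bar_end B (e, true) = dst_joint e.
Proof. by []. Qed.

(** Each end of a bar is a joint of its own, so the lines given by
    [special_lines] can be prescribed independently. *)
Lemma special_position : (forall Y, Y != set0 -> @bounded_at H Y) ->
  exists p, (#|edge H| <= rk (body_bar_coef p) setT)%N.
Proof.
move=> /(special_lines R)[s rk_s].
pose p (v : vert G) : 'rV[R]_3 := match [pick d | bar_end B d == v] with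
  | Some (e, false) => line_point R (s e)
  | Some (e, true) => line_end R e (s e)
  | None => 0 end.
have pE d : p (bar_end B d) = if d.2 then line_end R d.1 (s d.1) else line_point R (s d.1).
  rewrite /p; case: pickP => [d' /eqP/(@bar_end_inj _ _ B)->|/(_ d)]; last by rewrite eqxx.
  by case: d => e [].
have pS e : p (src_joint e) = line_point R (s e) by rewrite -bar_end_src pE.
have pD e : p (dst_joint e) = line_end R e (s e) by rewrite -bar_end_dst pE.
exists p; apply: leq_trans rk_s _; apply: eq_leq; congr rk.
apply/funext=> e; rewrite /body_bar_coef /line_coef /= pS pD; congr bar_coef.
rewrite /bar_vector /= -/(src_joint e) -/(dst_joint e) pS pD /line_end /gainR.
by apply/rowP=> k; rewrite !mxE; ring.
Qed.

End InducedFramework.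

(** * Positions of body-bar frameworks, and the count *)

Section Count.
Variables (R : realType) (H : gain_graph) (B : body_choice R H).
Let G := induced_graph B.
Implicit Types (p q : vert G -> 'rV[R]_3) (e : edge H).

Lemma induced_loopless (b : edge G) : src b != dst b.
Proof.
case: b => [[a b]|e] /=.
  rewrite (inj_eq (@joint_of_inj _ _ _ _)).
  exact: isostatic_loopless (body_isostatic B a).
by apply/eqP=> /(@bar_end_inj _ _ B (e, false) (e, true)).
Qed.

Lemma body_three_joints a : exists i j k : vert (body B a),
  [/\ i != j, j != k & k != i].
Proof.
by have /card_gt2P[i [j [k [_ ijk]]]] := body_card B a; exists i, j, k.
Qed.

(** Three joints of each body span a plane, expressed by a polynomial in their
    coordinates. *)
Definition noncollinear p : Prop := forall a, exists i j k : vert (body B a),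
  cross (p (joint_of i) - p (joint_of j)) (p (joint_of i) - p (joint_of k)) != 0.

Lemma noncollinear_span p : noncollinear p -> bodies_span p.
Proof.
move=> ncol a; have [i [j [k c0]]] := ncol a.
set x := p (joint_of i) - p (joint_of j) in c0.
set y := p (joint_of i) - p (joint_of k) in c0.
set s := (X in <<X>>%VS).
have mem_s (i' j' : vert (body B a)) : p (joint_of i') - p (joint_of j') \in s.
  by apply/allpairsP; exists (i', j'); rewrite !mem_enum.
have free_xy : free [:: x; y].
  rewrite free_cons span_seq1 seq1_free; apply/andP; split.
    by apply: contra c0 => /vlineP[c ->]; rewrite crossZl crossvv scaler0.
  by apply: contraNneq c0 => ->; rewrite cross_anti cross0l oppr0.
rewrite (leq_trans _ (dimvS (_ : (<<[:: x; y]>> <= <<s>>)%VS))) //.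
  by move: free_xy; rewrite /free => /eqP->.
by apply/sub_span=> z; rewrite !inE => /orP[/eqP->|/eqP->]; apply: mem_s.
Qed.

(** Distinct ends and noncollinear triples are polynomial conditions that can be
    met, so a generic position in the open cube satisfies all of them. *)
Lemma exists_body_bar_position :
  exists p, [/\ body_bar_position p, generic p & noncollinear p].
Proof.
have [i3 i3P] : exists i3 : forall a, vert (body B a) * vert (body B a) * vert (body B a),
    forall a, [/\ (i3 a).1.1 != (i3 a).1.2, (i3 a).1.2 != (i3 a).2
                & (i3 a).2 != (i3 a).1.1].
  have three a : exists ijk : vert (body B a) * vert (body B a) * vert (body B a),
      [/\ ijk.1.1 != ijk.1.2, ijk.1.2 != ijk.2 & ijk.2 != ijk.1.1].
    by have [i [j [k ijk]]] := body_three_joints a; exists (i, j, k).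
  by exists (fun a => sval (cid (three a))) => a; apply: (svalP (cid (three a))).
pose f (z : edge G + vert H) p : R := match z with
  | inl b => (p (src b) - p (dst b)) 0 0
  | inr a => let: (i, j, k) := i3 a in
      cross (p (joint_of i) - p (joint_of j)) (p (joint_of i) - p (joint_of k)) 0 0
  end.
have [||p [p01 gen fp]] := @exists_generic R G _ f.
- case=> [b|a]; first exact: poly_on_lines_diff.
  rewrite /f; case: (i3 a) => [[i j] k].
  by apply: poly_on_lines_cross => l; apply: poly_on_lines_diff.
- case=> [b|a] /=.
    exists (fun v => const_mx (v == src b)%:R); rewrite !mxE eqxx.
    by rewrite (eq_sym (dst b)) (negPf (induced_loopless b)) subr0 oner_neq0.
  case: (i3 a) (i3P a) => [[i j] k] /= [ij jk ki].
  exists (fun v => if v == joint_of j then delta_mx 0 1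
                   else if v == joint_of k then delta_mx 0 2%:R else 0).
  rewrite !(inj_eq (@joint_of_inj _ _ _ _)) !eqxx (negPf ij) (eq_sym i k) (negPf ki).
  rewrite (eq_sym k j) (negPf jk) crossE !mxE /=.
  by rewrite subrr mulr0 subr0 sub0r mulrNN mulr1 oner_neq0.
exists p; split=> //; last first.
  move=> a; have := fp (inr a); rewrite /f; case: (i3 a) => [[i j] k] c0; exists i, j, k.
  by apply: contraNneq c0 => ->; rewrite mxE.
split.
- by move=> v c; have /andP[/ltW-> ->] := p01 v c.
- move=> b; apply: contraNneq (fp (inl b)) => pb.
  by rewrite /f pb subrr mxE.
- apply: noncollinear_span => a.
  have := fp (inr a); rewrite /f; case: (i3 a) => [[i j] k] c0; exists i, j, k.
  by apply: contraNneq c0 => ->; rewrite mxE.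
Qed.

(** A solution of the body-bar system moves the joints by a translation, and the
    rotation vector of a body is parallel to all differences of its joints, hence
    zero. *)
Lemma noncollinear_rank p (v : vert H) : noncollinear p -> inf_rigid_torus p ->
  (#|coord H| <= rk (body_bar_coef p) setT + 3)%N.
Proof.
move=> ncol rigid; have <- : #|trans_coords v| = 3%N.
  by rewrite card_root_coords cards0.
apply: determined_rk => x sol x0.
have [t tE] := rigid _ (body_motion_infinitesimal sol).
have w0 a : part x true a = 0.
  have [i [j [k c0]]] := ncol a.
  have same (i' j' : vert (body B a)) : cross (p (joint_of i') - p (joint_of j')) (part x true a) = 0.
    have := tE (joint_of i'); rewrite -(tE (joint_of j')) /body_motion /velocity /= => /addIr E.
    by apply/eqP; rewrite crossBl subr_eq0 -eqr_opp -!cross_anti E.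
  exact: cross_common (same i j) (same i k) c0.
have t_a a : part x false a = t.
  have [j _] := body_three_joints a.
  by rewrite -(tE (joint_of j)) /body_motion /velocity /= w0 cross0l add0r.
have tv : part x false v = 0.
  by apply/rowP=> k; rewrite !mxE x0 // in_root_coords eqxx.
by case=> a bk; apply: part_eq0; rewrite ?w0 // t_a -(t_a v).
Qed.

Lemma poly_on_lines_body_bar e j : poly_on_lines (fun p => body_bar_coef p e j).
Proof.
have part (v : vert G) : poly_on_lines (fun p =>
    (if j.2.1 then cross (p v) (@bar_vector R G p (inr e))
     else @bar_vector R G p (inr e)) 0 j.2.2).
  case: j.2.1; last exact: poly_on_lines_bar.
  by apply: poly_on_lines_cross => k; [apply: poly_on_lines_coord|apply: poly_on_lines_bar].
by apply: poly_on_linesB; apply: poly_on_linesM; do ?[exact: poly_on_lines_const|exact: part].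
Qed.

(** The relative velocity of the ends of the bar is the cross product of the
    common rotation vector with the direction of the bar. *)
Lemma linked_solves p e x : linked x e -> \sum_j body_bar_coef p e j * x j = 0.
Proof.
case=> wE tE; rewrite body_bar_coef_sum /body_motion /velocity /= wE tE /bar_vector /gainR /=.
rewrite /dot sum3 -/(src_joint B e) -/(dst_joint B e).
by rewrite !(mxE, crossE) /=; ring.
Qed.

Lemma rk_setC_leq (I J : finType) (a : I -> J -> R) (Y : {set I}) :
  (rk a setT + #|Y| <= rk a Y + #|I|)%N.
Proof.
have := rk_submod a Y (~: Y); rewrite setUCr => sub.
have := rk_card a (~: Y); have := cardsC Y; move: sub; lia.
Qed.

(** Since all rows are independent, so are those of Y; they vanish on the linked
    assignments, of which [linked_free] provides enough. *)
Lemma rank_bounded p : (#|edge H| <= rk (body_bar_coef p) setT)%N ->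
  forall Y, Y != set0 -> @bounded_at H Y.
Proof.
move=> rk_p Y /set0Pn[e eY].
have sY : src e \in vertices_of Y by apply/mem_vertices_of; exists e; rewrite ?eqxx.
have [D [cardD freeD]] := linked_free R sY.
have fr : free_on (body_bar_coef p) Y D.
  move=> g; have [x lx xD] := freeD g; exists x => // e' e'Y.
  exact/linked_solves/lx.
have := free_rk fr; rewrite card_coord /bounded_at.
have := rk_setC_leq (body_bar_coef p) Y; move: cardD rk_p.
by set s := \sum_(1 <= i < _) _; lia.
Qed.

End Count.

Theorem theorem3p1 (R : realType) (H : gain_graph) (B : body_choice R H) :
  generically_minimally_rigid B <->
  (#|edge H|%:Z = 6 * #|vert H|%:Z - 3 /\
   forall Y : {set edge H}, Y != set0 ->
     #|Y|%:Z <= 6 * #|vertices_of Y|%:Z - 6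
                + \sum_(1 <= i < (gain_rank Y).+1) (3 - i%:Z)).
Proof.
have get_vert : #|edge H|%:Z = 6 * #|vert H|%:Z - 3 -> exists v : vert H, true.
  move=> count; have /card_gt0P[v _] : (0 < #|vert H|)%N by lia.
  by exists v.
split=> [[rigid count]|[count bound]]; split=> //.
  have [v _] := get_vert count.
  have [p [pos gen ncol]] := exists_body_bar_position B.
  have := noncollinear_rank v ncol (rigid p pos gen); rewrite card_coord => rk_p.
  by apply: (@rank_bounded _ _ _ p); move: rk_p; lia.
move=> p _ gen; have [v _] := get_vert count.
have [i _] := body_three_joints B v.
(* Of q0 only the nonvanishing of one minor of its body-bar matrix is kept, a
   condition that a generic position can share. *)
have [q0 rk0] := special_position B bound.
rewrite rk_setT in rk0.
have [f [g fg]] := minor_of_rank rk0.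
pose M (q : vert (induced_graph B) -> 'rV[R]_3) : 'M[R]_(#|edge H|, #|coord H|) :=
  \matrix_(i, j) body_bar_coef q (enum_val i) (enum_val j).
have [||q [_ genq qn0]] := @exists_generic R (induced_graph B) unit
  (fun _ q => \det (mxsub f g (M q))).
- move=> _; apply: poly_on_lines_det => k l.
  rewrite (_ : (fun q => _) = fun q => body_bar_coef q (enum_val (f k)) (enum_val (g l))).
    exact: poly_on_lines_body_bar.
  by apply/funext=> q; rewrite 2!mxE.
- by move=> _; exists q0.
apply/(@inf_rigid_rank R (induced_graph B) p (joint_of i)).
(* Rigidity passes from q to p through the rank. *)
apply: leq_trans (leq_add (generic_max_rank q gen) (leqnn 3)).
apply/(@inf_rigid_rank R (induced_graph B) q (joint_of i)).
apply: (generic_inf_rigid v genq).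
have rkq : (#|edge H| <= rk (body_bar_coef q) setT)%N.
  by rewrite rk_setT; apply: rank_of_minor (qn0 tt).
by rewrite card_coord; move: count rkq; lia.
Qed.
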